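(* Let $n,m\ge2$. The algebra maps $\mathcal L_q:U_q(\mathfrak{so}_{2n})\to Cl_q(nm)$ and $\mathcal R_q:U_q'(\mathfrak{so}_m)\to Cl_q(nm)$ induce commuting subalgebras of $\mathrm{End}\big(\bigwedge_q(V^{(nm)})\big)$: for all $x\in U_q(\mathfrak{so}_{2n})$ and $y\in U'_q(\mathfrak{so}_m)$, the operators by which $\mathcal L_q(x)$ and $\mathcal R_q(y)$ act on $\bigwedge_q(V^{(nm)})$ commute.
   Context: The base field is $\mathbb C(q)$, $q$ an indeterminate. $Cl_q(p)$ is the unital associative algebra generated by $\psi_a,\psi_a^\dagger,\omega_a^{\pm1}$ ($1\le a\le p$) with relations: the $\omega_a$ commute; $\omega_a\psi_b\omega_a^{-1}=q^{\delta_{ab}}\psi_b$; $\omega_a\psi_b^\dagger\omega_a^{-1}=q^{-\delta_{ab}}\psi_b^\dagger$; $\psi_a\psi_b+\psi_b\psi_a=0=\psi_a^\dagger\psi_b^\dagger+\psi_b^\dagger\psi_a^\dagger$; $\psi_a\psi_b^\dagger+\psi_b^\dagger\psi_a=0$ for $a\ne b$; $\psi_a\psi_a^\dagger=\frac{q\omega_a-q^{-1}\omega_a^{-1}}{q-q^{-1}}$, $\psi_a^\dagger\psi_a=-\frac{\omega_a-\omega_a^{-1}}{q-q^{-1}}$. As a $Cl_q(p)$-module, the braided exterior algebra $\bigwedge_q(V^{(p)})$ has basis $v(\ell)$, $\ell\in\{0,1\}^p$, with $\omega_a v(\ell)=q^{-\ell_a}v(\ell)$, $\psi_a v(\ell)=(-1)^{\ell_1+\cdots+\ell_{a-1}}v(\ell-e_a)$,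 $\psi_a^\dagger v(\ell)=(-1)^{\ell_1+\cdots+\ell_{a-1}}v(\ell+e_a)$, where $v(\ell')=0$ if $\ell'\notin\{0,1\}^p$. $U_q(\mathfrak{so}_{2n})$ has generators $E_i,F_i,K_i^{\pm1}$ ($1\le i\le n$) and the standard Drinfeld–Jimbo relations for the type $D_n$ Cartan matrix with simple roots $\alpha_i=e_i-e_{i+1}$ ($i<n$), $\alpha_n=e_{n-1}+e_n$. Set $k_{i,p}=\omega_{i+pn}^{-1}\omega_{i+1+pn}$ for $i<n$ and $k_{n,p}=(q\,\omega_{n-1+pn}\omega_{n+pn})^{-1}$, $0\le p\le m-1$. The map $\mathcal L_q$ is $K_i\mapsto\prod_{p=0}^{m-1}k_{i,p}$; for $i<n$, $E_i\mapsto\sum_{j=0}^{m-1}\psi^\dagger_{i+jn}\psi_{i+1+jn}\prod_{p<j}k_{i,p}$ and $F_i\mapsto\sum_{j=0}^{m-1}\big(\prod_{p>j}k_{i,p}^{-1}\big)\psi^\dagger_{i+1+jn}\psi_{i+jn}$; and $E_n\mapsto\sum_{j=0}^{m-1}\psi^\dagger_{n-1+jn}\psi^\dagger_{n+jn}\prod_{p<j}k_{n,p}$, $F_n\mapsto\sum_{j=0}^{m-1}\big(\prod_{p>j}k_{n,p}^{-1}\big)\psi_{n+jn}\psi_{n-1+jn}$. $U_q'(\mathfrak{so}_m)$ is the unital algebra generated by $B_1,\dots,B_{m-1}$ with $B_iB_j=B_jB_i$ for $|i-j|>1$ and $B_j^2B_{j\pm1}-(q+q^{-1})B_jB_{j\pm1}B_j+B_{j\pm1}B_j^2=B_{j\pm1}$.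 For $1\le j\le m-1$, $1\le b\le n$ put $\kappa_{b,j}=\omega_{b+(j-1)n}^{-1}\omega_{b+jn}$ and $\rho_q(E_j)=\sum_{b=1}^n\big(\prod_{a>b}\kappa_{a,j}\big)\psi^\dagger_{b+(j-1)n}\psi_{b+jn}$, $\rho_q(F_j)=\sum_{b=1}^n\big(\prod_{a<b}\kappa_{a,j}^{-1}\big)\psi^\dagger_{b+jn}\psi_{b+(j-1)n}$, $\rho_q(K_j)=\prod_{a=1}^n\kappa_{a,j}$. The map $\mathcal R_q$ is $B_j\mapsto\sqrt{-1}\,\big(\rho_q(F_j)-q\,\rho_q(K_j)^{-1}\rho_q(E_j)\big)$. *)

(* Defs.v *)
From HB Require Import structures.
From mathcomp Require Import all_boot all_order all_algebra.
From mathcomp Require Import boolp reals complex.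
Set Implicit Arguments.
Unset Strict Implicit.
Unset Printing Implicit Defensive.
Import Order.TTheory GRing.Theory Num.Theory.
Local Open Scope quotient_scope.
Local Open Scope ring_scope.

(* Unital associative algebras presented by generators and relations.  The
   type [pexpr F G] is the syntax of noncommutative polynomials over F in the
   generators G; [pcong rel] is the least congruence that makes it an
   associative unital F-algebra and contains [rel]; [palg rel] is the quotient,
   i.e. the free algebra on G modulo the two-sided ideal generated by the
   differences x - y for [rel x y]. *)

Inductive pexpr (F G : Type) : Type :=
| PGen of G
| PConst of F
| PAdd of pexpr F G & pexpr F G
| PMul of pexpr F G & pexpr F G.
Arguments PGen {F G} _.
Arguments PConst {F G} _.
Arguments PAdd {F G} _ _.
Arguments PMul {F G} _ _.

HB.instance Definition _ (F G : Type) := gen_eqMixin (pexpr F G).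
HB.instance Definition _ (F G : Type) := gen_choiceMixin (pexpr F G).

Declare Scope pexpr_scope.
Delimit Scope pexpr_scope with pe.
Bind Scope pexpr_scope with pexpr.
Notation "x + y" := (PAdd x y) : pexpr_scope.
Notation "x * y" := (PMul x y) : pexpr_scope.
Notation "c *: x" := (PMul (PConst c) x) : pexpr_scope.
Notation "- x" := (PMul (PConst (- 1)%R) x) : pexpr_scope.
Notation "x - y" := (PAdd x (- y)%pe) : pexpr_scope.
Notation "0" := (PConst 0%R) : pexpr_scope.
Notation "1" := (PConst 1%R) : pexpr_scope.

Inductive pcong (F : fieldType) (G : Type)
    (rel : pexpr F G -> pexpr F G -> Prop) : pexpr F G -> pexpr F G -> Prop :=
| pcong_rel x y of rel x y : pcong rel x y
| pcong_refl x : pcong rel x x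
| pcong_sym x y of pcong rel x y : pcong rel y x
| pcong_trans x y z of pcong rel x y & pcong rel y z : pcong rel x z
| pcong_add x x' y y' of pcong rel x x' & pcong rel y y' :
    pcong rel (x + y) (x' + y')
| pcong_mul x x' y y' of pcong rel x x' & pcong rel y y' :
    pcong rel (x * y) (x' * y')
| pcong_addA x y z : pcong rel (x + (y + z)) (x + y + z)
| pcong_addC x y : pcong rel (x + y) (y + x)
| pcong_add0 x : pcong rel (0 + x) x
| pcong_addN x : pcong rel (- x + x) 0
| pcong_mulA x y z : pcong rel (x * (y * z)) (x * y * z)
| pcong_mul1l x : pcong rel (1 * x) x
| pcong_mul1r x : pcong rel (x * 1) x
| pcong_mulDl x y z : pcong rel ((x + y) * z) (x * z + y * z)
| pcong_mulDr x y z : pcong rel (x * (y + z)) (x * y + x * z)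
| pcong_constD a b : pcong rel (PConst (a + b)%R) (PConst a + PConst b)
| pcong_constM a b : pcong rel (PConst (a * b)%R) (PConst a * PConst b)
| pcong_central a x : pcong rel (x * PConst a) (PConst a * x).

Section PresentedAlgebra.
Variables (F : fieldType) (G : Type) (rel : pexpr F G -> pexpr F G -> Prop).
Implicit Types x y z : pexpr F G.

Definition pequiv x y : bool := `[< pcong rel x y >].

Lemma pequiv_refl : reflexive pequiv.
Proof. by move=> x; apply/asboolP; apply: pcong_refl. Qed.
Lemma pequiv_sym : symmetric pequiv.
Proof.
by move=> x y; apply/idP/idP => /asboolP h; apply/asboolP; apply: pcong_sym.
Qed.
Lemma pequiv_trans : transitive pequiv.
Proof.
move=> y x z /asboolP h1 /asboolP h2; apply/asboolP.
exact: pcong_trans h1 h2.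
Qed.

Canonical pequiv_equiv := EquivRel pequiv pequiv_refl pequiv_sym pequiv_trans.

Definition palg : Type := {eq_quot pequiv}.
HB.instance Definition _ := Choice.on palg.

Definition pclass x : palg := \pi_({eq_quot pequiv}) x.
Definition prepr (u : palg) : pexpr F G := repr (u : {eq_quot pequiv}).

Lemma preprK u : pclass (prepr u) = u. Proof. exact: reprK. Qed.

Lemma pclassP x y : pclass x = pclass y <-> pcong rel x y.
Proof.
split=> [/eqP|h]; first by rewrite eqmodE => /asboolP.
by apply/eqP; rewrite eqmodE; apply/asboolP.
Qed.

Lemma prepr_cong x : pcong rel (prepr (pclass x)) x.
Proof. by apply/pclassP; rewrite preprK. Qed.

Definition padd (u v : palg) := pclass (prepr u + prepr v)%pe.
Definition pmul (u v : palg) := pclass (prepr u * prepr v)%pe.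
Definition popp (u : palg) := pclass (- prepr u)%pe.
Definition pscale (c : F) (u : palg) := pclass (c *: prepr u)%pe.

Lemma paddE x y : padd (pclass x) (pclass y) = pclass (x + y)%pe.
Proof. by apply/pclassP; apply: pcong_add; apply: prepr_cong. Qed.
Lemma pmulE x y : pmul (pclass x) (pclass y) = pclass (x * y)%pe.
Proof. by apply/pclassP; apply: pcong_mul; apply: prepr_cong. Qed.
Lemma pscaleE c x : pscale c (pclass x) = pclass (c *: x)%pe.
Proof.
by apply/pclassP; apply: pcong_mul; [apply: pcong_refl|apply: prepr_cong].
Qed.
Lemma poppE x : popp (pclass x) = pclass (- x)%pe.
Proof. exact: pscaleE. Qed.

Lemma palgP (P : palg -> Prop) : (forall x, P (pclass x)) -> forall u, P u.
Proof. by move=> h u; rewrite -(preprK u). Qed.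

Lemma paddA : associative padd.
Proof.
elim/palgP=> x; elim/palgP=> y; elim/palgP=> z; rewrite !paddE.
by apply/pclassP; apply: pcong_addA.
Qed.
Lemma paddC : commutative padd.
Proof.
elim/palgP=> x; elim/palgP=> y; rewrite !paddE.
by apply/pclassP; apply: pcong_addC.
Qed.
Lemma padd0 : left_id (pclass 0%pe) padd.
Proof.
by elim/palgP=> x; rewrite !paddE; apply/pclassP; apply: pcong_add0.
Qed.
Lemma paddN : left_inverse (pclass 0%pe) popp padd.
Proof.
elim/palgP=> x; rewrite poppE !paddE.
by apply/pclassP; apply: pcong_addN.
Qed.
HB.instance Definition _ := GRing.isZmodule.Build palg paddA paddC padd0 paddN.

Lemma pmulA : associative pmul.
Proof.
elim/palgP=> x; elim/palgP=> y; elim/palgP=> z; rewrite !pmulE.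
by apply/pclassP; apply: pcong_mulA.
Qed.
Lemma pmul1l : left_id (pclass 1%pe) pmul.
Proof.
by elim/palgP=> x; rewrite !pmulE; apply/pclassP; apply: pcong_mul1l.
Qed.
Lemma pmul1r : right_id (pclass 1%pe) pmul.
Proof.
by elim/palgP=> x; rewrite !pmulE; apply/pclassP; apply: pcong_mul1r.
Qed.
Lemma pmulDl : left_distributive pmul padd.
Proof.
elim/palgP=> x; elim/palgP=> y; elim/palgP=> z; rewrite !(pmulE, paddE).
by apply/pclassP; apply: pcong_mulDl.
Qed.
Lemma pmulDr : right_distributive pmul padd.
Proof.
elim/palgP=> x; elim/palgP=> y; elim/palgP=> z; rewrite !(pmulE, paddE).
by apply/pclassP; apply: pcong_mulDr.
Qed.
HB.instance Definition _ :=
  GRing.Zmodule_isPzRing.Build palg pmulA pmul1l pmul1r pmulDl pmulDr.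

Lemma pscaleA a b u : pscale a (pscale b u) = pscale (a * b) u.
Proof.
elim/palgP: u => x; rewrite !pscaleE; apply/pclassP.
apply: pcong_trans (pcong_mulA _ _ _ _) _.
by apply: pcong_mul; [apply/pcong_sym/pcong_constM | apply: pcong_refl].
Qed.
Lemma pscale1 : left_id 1 pscale.
Proof.
by elim/palgP=> x; rewrite pscaleE; apply/pclassP; apply: pcong_mul1l.
Qed.
Lemma pscaleDr : right_distributive pscale +%R.
Proof.
move=> a; elim/palgP=> x; elim/palgP=> y.
rewrite [in LHS]/GRing.add [in RHS]/GRing.add /= !(pscaleE, paddE).
by apply/pclassP; apply: pcong_mulDr.
Qed.
Lemma pscaleDl u : {morph pscale^~ u : a b / a + b}.
Proof.
move=> a b; elim/palgP: u => x /=.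
rewrite [in RHS]/GRing.add /= !(pscaleE, paddE).
apply/pclassP; apply: pcong_trans (pcong_mulDl _ _ _ _).
by apply: pcong_mul; [apply: pcong_constD | apply: pcong_refl].
Qed.
HB.instance Definition _ := GRing.Zmodule_isLmodule.Build F palg
  pscaleA pscale1 pscaleDr pscaleDl.

Lemma palg_scalerAl a (u v : palg) : a *: (u * v) = (a *: u) * v.
Proof.
elim/palgP: u => x; elim/palgP: v => y.
rewrite /GRing.scale /GRing.mul /= !(pscaleE, pmulE).
by apply/pclassP; apply: pcong_mulA.
Qed.
Lemma palg_scalerAr a (u v : palg) : a *: (u * v) = u * (a *: v).
Proof.
elim/palgP: u => x; elim/palgP: v => y.
rewrite /GRing.scale /GRing.mul /= !(pscaleE, pmulE).
apply/pclassP; apply: pcong_trans (pcong_mulA _ _ _ _) _.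
apply: pcong_trans (pcong_sym (pcong_mulA _ _ _ _)).
by apply: pcong_mul; [apply/pcong_sym/pcong_central | apply: pcong_refl].
Qed.

Definition pgen (g : G) : palg := pclass (PGen g).

Lemma pclass_const a : pclass (PConst a) = a *: (1 : palg).
Proof.
rewrite {1}/GRing.scale /= /GRing.one /= pscaleE.
by apply/pclassP/pcong_sym/pcong_mul1r.
Qed.
Lemma pclassD x y : pclass (x + y)%pe = pclass x + pclass y.
Proof. by rewrite /GRing.add /= paddE. Qed.
Lemma pclassM x y : pclass (x * y)%pe = pclass x * pclass y.
Proof. by rewrite /GRing.mul /= pmulE. Qed.
Lemma pclassZ a x : pclass (a *: x)%pe = a *: pclass x.
Proof. by rewrite /GRing.scale /= pscaleE. Qed.
Lemma pclassN x : pclass (- x)%pe = - pclass x.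
Proof. by rewrite pclassZ scaleN1r. Qed.

Section Lift.
Variables (B : lmodType F) (mulB : B -> B -> B) (oneB : B) (g : G -> B).
Hypothesis mulBA : associative mulB.
Hypotheses (mulB1l : left_id oneB mulB) (mulB1r : right_id oneB mulB).
Hypotheses (mulBDl : left_distributive mulB +%R)
           (mulBDr : right_distributive mulB +%R).
Hypotheses (mulBAl : forall a u v, a *: mulB u v = mulB (a *: u) v)
           (mulBAr : forall a u v, a *: mulB u v = mulB u (a *: v)).

Fixpoint peval x : B :=
  match x with
  | PGen t => g t
  | PConst a => a *: oneB
  | PAdd x y => peval x + peval y
  | PMul x y => mulB (peval x) (peval y)
  end.

Hypothesis grel : forall x y, rel x y -> peval x = peval y.

Lemma peval_cong x y : pcong rel x y -> peval x = peval y.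
Proof.
elim=> {x y} //=.
- by move=> x y z _ -> _ ->.
- by move=> x x' y y' _ -> _ ->.
- by move=> x x' y y' _ -> _ ->.
- by move=> x y z; rewrite addrA.
- by move=> x y; rewrite addrC.
- by move=> x; rewrite scale0r add0r.
- by move=> x; rewrite -mulBAl mulB1l scaleN1r addNr scale0r.
- by move=> x; rewrite scale1r.
- by move=> x; rewrite scale1r.
- by move=> a b; rewrite scalerDl.
- by move=> a b; rewrite -mulBAl mulB1l scalerA.
- by move=> a x; rewrite -mulBAl -mulBAr mulB1l mulB1r.
Qed.

Definition plift (u : palg) : B := peval (prepr u).

Lemma plift_pclass x : plift (pclass x) = peval x.
Proof. exact/peval_cong/prepr_cong. Qed.
Lemma plift_gen t : plift (pgen t) = g t.
Proof. exact: plift_pclass. Qed.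
Lemma pliftD u v : plift (u + v) = plift u + plift v.
Proof.
by elim/palgP: u => x; elim/palgP: v => y; rewrite -pclassD !plift_pclass.
Qed.
Lemma pliftM u v : plift (u * v) = mulB (plift u) (plift v).
Proof.
by elim/palgP: u => x; elim/palgP: v => y; rewrite -pclassM !plift_pclass.
Qed.
Lemma pliftZ a u : plift (a *: u) = a *: plift u.
Proof.
by elim/palgP: u => x; rewrite -pclassZ !plift_pclass /= -mulBAl mulB1l.
Qed.
Lemma plift1 : plift 1 = oneB.
Proof. by rewrite plift_pclass /= scale1r. Qed.
Lemma palg_neq0 : oneB != 0 -> (1 : palg) != 0.
Proof.
apply: contraNneq => h; rewrite -plift1 h.
by rewrite -(scale0r (0 : palg)) pliftZ scale0r.
Qed.
End Lift.

(* A morphism out of a presented algebra is determined on the generators. *)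
Lemma palg_ext (B : algType F) (f h : palg -> B) :
    linear f -> linear h -> monoid_morphism f -> monoid_morphism h ->
  (forall t, f (pgen t) = h (pgen t)) -> f =1 h.
Proof.
move=> fl hl [f1 fM] [h1 hM] fh.
have D k (kl : linear k) (u v : palg) : k (u + v) = k u + k v :> B.
  by have := kl 1 u v; rewrite !scale1r.
have Z k (kl : linear k) a (u : palg) : k (a *: u) = a *: k u :> B.
  have k0 : k 0 = 0 by apply: (addrI (k 0)); rewrite -D // !addr0.
  by have := kl a u 0; rewrite k0 !addr0.
elim/palgP; elim=> [t|a|x IHx y IHy|x IHx y IHy]; first exact: fh.
- by rewrite pclass_const !Z // f1 h1.
- by rewrite pclassD !D // IHx IHy.
- by rewrite pclassM fM hM IHx IHy.
Qed.

End PresentedAlgebra.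

Arguments pgen {F G} rel g.
Arguments palg {F G} rel.

(* C(q): R is a model of the real numbers, so R[i] is a model of C. *)
Definition Cq (R : realType) : fieldType := {fraction {poly R[i]}}.
Definition q_ {R : realType} : Cq R := tofrac ('X : {poly R[i]}).
Definition sqrtN1 {R : realType} : Cq R :=
  tofrac ((Complex 0 1 : R[i])%:P : {poly R[i]}).

Section BaseField.
Variable R : realType.

Lemma q_neq0 : q_ != 0 :> Cq R.
Proof. by rewrite /q_ tofrac_eq0 polyX_eq0. Qed.

Lemma qqV_neq0 : q_ - q_^-1 != 0 :> Cq R.
Proof.
apply/eqP => /(congr1 (fun x => q_ * x)).
rewrite mulr0 mulrBr mulfV ?q_neq0 // => /eqP.
rewrite subr_eq0 -expr2 /q_ -tofracXn -tofrac1 tofrac_eq => /eqP h.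
by have := size_polyXn R[i] 2; rewrite h size_polyC oner_eq0.
Qed.

Lemma sqrtN1_sq : sqrtN1 ^+ 2 = -1 :> Cq R.
Proof.
rewrite /sqrtN1 -tofracXn -polyC_exp sqr_i.
by rewrite polyCN tofracN tofrac1.
Qed.
End BaseField.

(* Generators are indexed from 0: 'I_p = {0, ..., p-1} stands for 1, ..., p. *)
Inductive clq_gen (p : nat) : Type :=
| GPsi of 'I_p | GPsid of 'I_p | GOmega of 'I_p | GOmegaV of 'I_p.

Section CliffordRelations.
Variables (F : fieldType) (q : F) (p : nat).
Local Notation ps a := (PGen (GPsi a) : pexpr F (clq_gen p)).
Local Notation pd a := (PGen (GPsid a) : pexpr F (clq_gen p)).
Local Notation om a := (PGen (GOmega a) : pexpr F (clq_gen p)).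
Local Notation omV a := (PGen (GOmegaV a) : pexpr F (clq_gen p)).
Local Open Scope pexpr_scope.

Inductive clq_rel :
  pexpr F (clq_gen p) -> pexpr F (clq_gen p) -> Prop :=
| clq_omV a : clq_rel (om a * omV a) 1
| clq_Vom a : clq_rel (omV a * om a) 1
| clq_omC a b : clq_rel (om a * om b) (om b * om a)
| clq_om_ps a b :
    clq_rel (om a * ps b * omV a) ((q ^ (a == b)%:Z)%R *: ps b)
| clq_om_pd a b :
    clq_rel (om a * pd b * omV a) ((q ^ (- (a == b)%:Z))%R *: pd b)
| clq_ps_ps a b : clq_rel (ps a * ps b + ps b * ps a) 0
| clq_pd_pd a b : clq_rel (pd a * pd b + pd b * pd a) 0
| clq_ps_pd a b of a != b : clq_rel (ps a * pd b + pd b * ps a) 0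
| clq_pspd a :
    clq_rel (ps a * pd a)
      (((q - q^-1)^-1)%R *: (q *: om a - (q^-1)%R *: omV a))
| clq_pdps a :
    clq_rel (pd a * ps a) (- (((q - q^-1)^-1)%R *: (om a - omV a))).
End CliffordRelations.

(* The braided exterior algebra, as the vector space with basis [vbasis l] for
   l in {0,1}^p; [gen_act] gives its module structure over the q-Clifford
   algebra on generators, extended to the whole algebra by [ext_op]. *)
Definition bits (p : nat) := {ffun 'I_p -> bool}.
Definition ext (F : fieldType) (p : nat) := {ffun bits p -> F^o}.
HB.instance Definition _ (F : fieldType) p := Vector.on (ext F p).

Section ExteriorModule.
Variables (F : fieldType) (q : F) (p : nat).
Implicit Types (a b : 'I_p) (l : bits p).

Definition vbasis l : ext F p := [ffun l' => (l' == l)%:R].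

(* l - e_a if l_a = 1, and l + e_a if l_a = 0 *)
Definition flip a l : bits p := [ffun b => (b == a) (+) l b].

Definition jw_sign a l : F := (-1) ^+ (\sum_(b < p | (b < a)%N) l b)%N.

Definition lin_ext_fun (g : bits p -> ext F p) (f : ext F p) : ext F p :=
  \sum_l (f l : F) *: g l.
Lemma lin_ext_fun_linear g : linear (lin_ext_fun g).
Proof.
move=> c f h; rewrite /lin_ext_fun scaler_sumr -big_split /=.
by apply: eq_bigr => l _; rewrite !ffunE scalerDl scalerA.
Qed.
HB.instance Definition _ g :=
  GRing.isLinear.Build _ _ _ _ (lin_ext_fun g) (@lin_ext_fun_linear g).

(* The endomorphism with values g on the basis [vbasis]. *)
Definition lin_ext (g : bits p -> ext F p) : 'End(ext F p) :=
  linfun (lin_ext_fun g).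

Definition gen_act (t : clq_gen p) : 'End(ext F p) :=
  match t with
  | GPsi a => lin_ext (fun l =>
      if l a then jw_sign a l *: vbasis (flip a l) else 0)
  | GPsid a => lin_ext (fun l =>
      if l a then 0 else jw_sign a l *: vbasis (flip a l))
  | GOmega a => lin_ext (fun l => (q ^ (- (l a)%:Z) : F) *: vbasis l)
  | GOmegaV a => lin_ext (fun l => (q ^ (l a)%:Z : F) *: vbasis l)
  end.

Lemma vbasis_neq0 l : vbasis l != 0.
Proof.
apply/eqP => /ffunP/(_ l); rewrite !ffunE eqxx /= => /eqP.
by rewrite oner_eq0.
Qed.

Lemma lin_extE g l : lin_ext g (vbasis l) = g l.
Proof.
rewrite lfunE /= /lin_ext_fun (bigD1 l) //= ffunE eqxx scale1r.
rewrite big1 ?addr0 // => l' ne; rewrite ffunE (negbTE ne).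
by rewrite scale0r.
Qed.

Lemma ext_decomp (f : ext F p) : f = \sum_l (f l : F) *: vbasis l.
Proof.
apply/ffunP => l; rewrite sum_ffunE (bigD1 l) //= big1 ?addr0.
  by rewrite !ffunE eqxx /GRing.scale /= mulr1.
move=> l' ne; rewrite !ffunE eq_sym (negbTE ne) /GRing.scale /=.
by rewrite mulr0.
Qed.

Lemma endext_eq (f h : 'End(ext F p)) :
  (forall l, f (vbasis l) = h (vbasis l)) -> f = h.
Proof.
move=> fh; apply/lfunP => u; rewrite (ext_decomp u) !linear_sum.
by apply: eq_bigr => l _; rewrite !linearZ /= fh.
Qed.

Lemma flipK a : involutive (flip a).
Proof. by move=> l; apply/ffunP => b; rewrite !ffunE addbA addbb. Qed.
Lemma flipC a b l : flip a (flip b l) = flip b (flip a l).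
Proof. by apply/ffunP => c; rewrite !ffunE addbCA. Qed.
Lemma flip_same a l : flip a l a = ~~ l a.
Proof. by rewrite ffunE eqxx. Qed.
Lemma flip_other a b l : a != b -> flip a l b = l b.
Proof. by rewrite ffunE eq_sym => /negbTE ->. Qed.

Lemma jw_sign_le a b l : (b <= a)%N -> jw_sign b (flip a l) = jw_sign b l.
Proof.
move=> ba; congr (_ ^+ _); apply: eq_bigr => c cb; rewrite ffunE.
suff -> : (c == a) = false by [].
by apply/eqP => e; move: cb; rewrite e ltnNge ba.
Qed.
Lemma jw_sign_lt a b l : (a < b)%N -> jw_sign b (flip a l) = - jw_sign b l.
Proof.
move=> ab; rewrite /jw_sign.
rewrite (bigD1 a) //= [in RHS](bigD1 a) //= flip_same !exprD.
rewrite (eq_bigr (fun c => l c : nat)); last first.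
  by move=> c /andP[_ ne]; rewrite flip_other // eq_sym.
by rewrite -mulNr; congr (_ * _); case: (l a); rewrite ?expr0 ?expr1 ?opprK.
Qed.
Lemma jw_sign_sq a l : jw_sign a l * jw_sign a l = 1.
Proof. by rewrite -expr2 sqrr_sign. Qed.

Lemma jw_sign_anti a b l : a != b ->
  jw_sign b l * jw_sign a (flip b l) = - (jw_sign a l * jw_sign b (flip a l)).
Proof.
rewrite -val_eqE neq_ltn => /orP[] h.
  by rewrite (jw_sign_le _ (ltnW h)) (jw_sign_lt _ h) mulrN opprK mulrC.
by rewrite (jw_sign_lt _ h) (jw_sign_le _ (ltnW h)) mulrN mulrC.
Qed.

Local Notation ev :=
  (peval (@comp_lfun _ (ext F p) (ext F p) (ext F p)) \1%VF gen_act).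

Hypotheses (q0 : q != 0) (qq0 : q - q^-1 != 0).

Let actE := (comp_lfunE, add_lfunE, scale_lfunE, id_lfunE, lin_extE).
Let linE := (lin_extE, linear0, scaler0, scale1r, flip_same).

Lemma gen_act_rel x y : clq_rel q x y -> ev x = ev y.
Proof.
have qD (c d : int) : q ^ c * q ^ d = q ^ (c + d) by rewrite expfzDr.
have h0 (d : ext F p) : 0 *: d = 0 by rewrite scale0r.
have jw2 a l : jw_sign a l * jw_sign a (flip a l) = 1.
  by rewrite jw_sign_le // jw_sign_sq.
case=> {x y} /= [a|a|a b|a b|a b|a b|a b|a b ab|a|a]; apply: endext_eq => l;
  rewrite ?actE ?linearZ /= ?linE.
- by rewrite scalerA qD subrr expr0z scale1r.
- by rewrite scalerA qD addNr expr0z scale1r.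
- by rewrite !scalerA mulrC.
- case lb: (l b); rewrite ?linE // linearZ /= linE !scalerA; congr (_ *: _).
  rewrite mulrAC qD; congr (q ^ _ * _).
  have [ab|ab] := eqVneq a b; first by rewrite ab flip_same lb.
  by rewrite flip_other 1?eq_sym // subrr.
- case lb: (l b); rewrite ?linE // linearZ /= linE !scalerA; congr (_ *: _).
  rewrite mulrAC qD; congr (q ^ _ * _).
  have [ab|ab] := eqVneq a b; first by rewrite ab flip_same lb.
  by rewrite flip_other 1?eq_sym // subrr oppr0.
- rewrite h0; have [->|ab] := eqVneq a b.
    by case lb: (l b); rewrite ?linearZ /= ?linE /= ?lb ?linE /= ?addr0.
  have ba : b != a by rewrite eq_sym.
  case lb: (l b); case la: (l a); rewrite ?linearZ /= ?linE /= ?flip_other //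
    ?la ?lb ?linE ?addr0 //.
  by rewrite !scalerA flipC -scalerDl jw_sign_anti // addNr scale0r.
- rewrite h0; have [->|ab] := eqVneq a b.
    by case lb: (l b); rewrite ?linearZ /= ?linE /= ?lb ?linE /= ?addr0.
  have ba : b != a by rewrite eq_sym.
  case lb: (l b); case la: (l a); rewrite ?linearZ /= ?linE /= ?flip_other //
    ?la ?lb ?linE ?addr0 //.
  by rewrite !scalerA flipC -scalerDl jw_sign_anti // addNr scale0r.
- have ba : b != a by rewrite eq_sym.
  rewrite h0.
  case lb: (l b); case la: (l a); rewrite ?linearZ /= ?linE /= ?flip_other //
    ?la ?lb ?linE ?addr0 //.
  by rewrite !scalerA flipC -scalerDl jw_sign_anti // addNr scale0r.
- have -> : q ^ (- (l a)%:Z) *: (q *: vbasis l) +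
      q^-1 *: (q ^ (l a)%:Z *: (-1 *: vbasis l)) =
      (if l a then 0 else q - q^-1) *: vbasis l.
    rewrite !scalerA -scalerDl; congr (_ *: _); case: (l a).
      by rewrite exprN1 expr1z mulVf // mul1r addrN.
    by rewrite oppr0 expr0z mul1r mulr1 mulrN1.
  case la: (l a); first by rewrite linear0 h0 scaler0.
  by rewrite linearZ /= linE flip_same la /= !scalerA jw2 flipK mulVf.
- have -> : q ^ (- (l a)%:Z) *: vbasis l +
      q ^ (l a)%:Z *: (-1 *: vbasis l) =
      (if l a then - (q - q^-1) else 0) *: vbasis l.
    rewrite !scalerA -{1}[vbasis l]scale1r scalerA mulr1 -scalerDl.
    congr (_ *: _); case: (l a).
      by rewrite exprN1 expr1z mulrN1 opprB.
    by rewrite oppr0 expr0z mulrN1 subrr.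
  case la: (l a); last by rewrite linear0 h0 !scaler0.
  rewrite linearZ /= linE flip_same la /= !scalerA jw2 flipK.
  by rewrite mulrN1 mulrNN mulVf.
Qed.
Definition ext_op : palg (@clq_rel F q p) -> 'End(ext F p) :=
  plift (@comp_lfun _ _ _ _) \1%VF gen_act.

Local Ltac lift_tac :=
  first [ exact: gen_act_rel | exact: comp_lfunA | exact: comp_lfun1l
        | exact: comp_lfun1r | exact: comp_lfunDl | exact: comp_lfunDr
        | by move=> *; rewrite comp_lfunZl
        | by move=> *; rewrite comp_lfunZr ].

Lemma ext_opD u v : ext_op (u + v) = ext_op u + ext_op v.
Proof. by apply: pliftD; lift_tac. Qed.
Lemma ext_opZ (c : F) u : ext_op (c *: u) = c *: ext_op u.
Proof. by apply: pliftZ; lift_tac. Qed.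
Lemma ext_op1 : ext_op 1 = \1%VF.
Proof. by apply: plift1; lift_tac. Qed.
Lemma ext_opM u v : ext_op (u * v) = (ext_op u \o ext_op v)%VF.
Proof. by apply: pliftM; lift_tac. Qed.
Lemma ext_op_gen t : ext_op (pgen _ t) = gen_act t.
Proof. by apply: plift_gen; lift_tac. Qed.

Lemma clq_neq0 : (1 : palg (@clq_rel F q p)) != 0.
Proof.
apply/eqP => h.
have e0 : ext_op 0 = 0.
  by rewrite -(scale0r (0 : palg (@clq_rel F q p))) ext_opZ scale0r.
pose l0 : bits p := [ffun=> false].
have /eqP := vbasis_neq0 l0; apply.
by rewrite -[LHS]id_lfunE -ext_op1 h e0 zero_lfunE.
Qed.
End ExteriorModule.

Section Clq.
Variables (R : realType) (p : nat).

Definition Clq : Type := palg (@clq_rel (Cq R) q_ p).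
HB.instance Definition _ := GRing.PzRing.on Clq.
HB.instance Definition _ := GRing.Lmodule.on Clq.

Lemma Clq_neq0 : (1 : Clq) != 0.
Proof. exact: clq_neq0 (q_neq0 R) (qqV_neq0 R). Qed.

HB.instance Definition _ := GRing.PzSemiRing_isNonZero.Build Clq Clq_neq0.
HB.instance Definition _ :=
  GRing.Lmodule_isLalgebra.Build (Cq R) Clq (@palg_scalerAl _ _ _).
HB.instance Definition _ :=
  GRing.Lalgebra_isAlgebra.Build (Cq R) Clq (@palg_scalerAr _ _ _).

Definition psi (a : 'I_p) : Clq := pgen _ (GPsi a).
Definition psid (a : 'I_p) : Clq := pgen _ (GPsid a).
Definition omega (a : 'I_p) : Clq := pgen _ (GOmega a).
Definition omegaV (a : 'I_p) : Clq := pgen _ (GOmegaV a).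

(* The operator by which an element of the q-Clifford algebra acts on the
   braided exterior algebra. *)
Definition ext_act : Clq -> 'End(ext (Cq R) p) := @ext_op (Cq R) q_ p.

Lemma ext_act_linear : linear ext_act.
Proof.
move=> a u v; rewrite /ext_act.
rewrite (ext_opD (q_neq0 R) (qqV_neq0 R)) (ext_opZ (q_neq0 R) (qqV_neq0 R)) //.
Qed.
Lemma ext_act1 : ext_act 1 = \1%VF.
Proof. exact: ext_op1 (q_neq0 R) (qqV_neq0 R). Qed.
Lemma ext_actM u v : ext_act (u * v) = (ext_act u \o ext_act v)%VF.
Proof. exact: ext_opM (q_neq0 R) (qqV_neq0 R) u v. Qed.
Lemma ext_act_gen t : ext_act (pgen _ t) = gen_act q_ t.
Proof. exact: ext_op_gen (q_neq0 R) (qqV_neq0 R) t. Qed.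
End Clq.

(* Type D_n with n >= 2, simple roots indexed from 0.  [ordS i] and
   [ord_pred i] are i + 1 and i - 1 here: for n >= 2 neither wraps around in the
   branch where it is used. *)
Definition simple_root (n : nat) (i : 'I_n) : 'rV[int]_n :=
  if (i.+1 < n)%N then delta_mx 0 i - delta_mx 0 (ordS i)
  else delta_mx 0 (ord_pred i) + delta_mx 0 i.

(* All roots have square length 2, so the Cartan matrix is the Gram matrix. *)
Definition cartanD (n : nat) (i j : 'I_n) : int :=
  \sum_k simple_root i 0 k * simple_root j 0 k.

Inductive uqso_gen (n : nat) : Type :=
| GE of 'I_n | GF of 'I_n | GK of 'I_n | GKV of 'I_n.

Section UqsoRelations.
Variables (F : fieldType) (q : F) (n : nat).
Local Notation E i := (PGen (GE i) : pexpr F (uqso_gen n)).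
Local Notation Fg i := (PGen (GF i) : pexpr F (uqso_gen n)).
Local Notation K i := (PGen (GK i) : pexpr F (uqso_gen n)).
Local Notation KV i := (PGen (GKV i) : pexpr F (uqso_gen n)).
Local Open Scope pexpr_scope.

Inductive uqso_rel :
  pexpr F (uqso_gen n) -> pexpr F (uqso_gen n) -> Prop :=
| uqso_KV i : uqso_rel (K i * KV i) 1
| uqso_VK i : uqso_rel (KV i * K i) 1
| uqso_KK i j : uqso_rel (K i * K j) (K j * K i)
| uqso_KE i j : uqso_rel (K i * E j * KV i) ((q ^ cartanD i j)%R *: E j)
| uqso_KF i j : uqso_rel (K i * Fg j * KV i) ((q ^ (- cartanD i j))%R *: Fg j)
| uqso_EF i : uqso_rel (E i * Fg i - Fg i * E i)
    (((q - q^-1)^-1)%R *: (K i - KV i))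
| uqso_EF0 i j of i != j : uqso_rel (E i * Fg j - Fg j * E i) 0
| uqso_serreE0 i j of cartanD i j = 0%R : uqso_rel (E i * E j) (E j * E i)
| uqso_serreE1 i j of cartanD i j = (-1)%R :
    uqso_rel (E i * E i * E j - (q + q^-1)%R *: (E i * E j * E i)
              + E j * E i * E i) 0
| uqso_serreF0 i j of cartanD i j = 0%R : uqso_rel (Fg i * Fg j) (Fg j * Fg i)
| uqso_serreF1 i j of cartanD i j = (-1)%R :
    uqso_rel (Fg i * Fg i * Fg j - (q + q^-1)%R *: (Fg i * Fg j * Fg i)
              + Fg j * Fg i * Fg i) 0.

Definition uqso_counit (t : uqso_gen n) : F^o :=
  match t with GE _ | GF _ => 0%R | GK _ | GKV _ => 1%R end.

Local Open Scope ring_scope.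
Lemma uqso_counit_rel x y : uqso_rel x y ->
  peval *%R 1 uqso_counit x = peval *%R 1 uqso_counit y.
Proof.
by case=> {x y} /= *; rewrite /GRing.scale /= ?(mulr0, mul0r, mulr1, mul1r,
  addr0, subrr).
Qed.
End UqsoRelations.

Section Uqso.
Variables (R : realType) (n : nat).

Definition Uqso2n : Type := palg (@uqso_rel (Cq R) q_ n).
HB.instance Definition _ := GRing.PzRing.on Uqso2n.
HB.instance Definition _ := GRing.Lmodule.on Uqso2n.

Lemma Uqso2n_neq0 : (1 : Uqso2n) != 0.
Proof.
apply: (@palg_neq0 _ _ _ (Cq R)^o *%R 1 (@uqso_counit _ n)).
- exact: mulrA.
- exact: mul1r.
- exact: mulr1.
- exact: mulrDl.
- exact: mulrDr.
- exact: scalerAl.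
- exact: scalerAr.
- exact: uqso_counit_rel.
exact: oner_neq0.
Qed.

HB.instance Definition _ := GRing.PzSemiRing_isNonZero.Build Uqso2n Uqso2n_neq0.
HB.instance Definition _ :=
  GRing.Lmodule_isLalgebra.Build (Cq R) Uqso2n (@palg_scalerAl _ _ _).
HB.instance Definition _ :=
  GRing.Lalgebra_isAlgebra.Build (Cq R) Uqso2n (@palg_scalerAr _ _ _).

Definition uqE (i : 'I_n) : Uqso2n := pgen _ (GE i).
Definition uqF (i : 'I_n) : Uqso2n := pgen _ (GF i).
Definition uqK (i : 'I_n) : Uqso2n := pgen _ (GK i).
Definition uqKV (i : 'I_n) : Uqso2n := pgen _ (GKV i).
End Uqso.

(* Generators B_1, ..., B_{m-1} of U'_q(so_m), indexed from 0. *)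
Inductive uqso'_gen (m : nat) : Type := GB of 'I_m.-1.

Section Uqso'Relations.
Variables (F : fieldType) (q : F) (m : nat).
Local Notation B i := (PGen (GB i) : pexpr F (uqso'_gen m)).
Local Open Scope pexpr_scope.

Inductive uqso'_rel :
  pexpr F (uqso'_gen m) -> pexpr F (uqso'_gen m) -> Prop :=
| uqso'_far (i j : 'I_m.-1) of (i.+1 < j)%N || (j.+1 < i)%N :
    uqso'_rel (B i * B j) (B j * B i)
| uqso'_near (j k : 'I_m.-1) of (k == j.+1 :> nat) || (j == k.+1 :> nat) :
    uqso'_rel (B j * B j * B k - (q + q^-1)%R *: (B j * B k * B j)
               + B k * B j * B j) (B k).

Local Open Scope ring_scope.
Lemma uqso'_counit_rel x y : uqso'_rel x y ->
  peval *%R 1 (fun=> 0 : F^o) x = peval *%R 1 (fun=> 0) y.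
Proof.
by case=> {x y} /= *; rewrite /GRing.scale /= ?(mulr0, mul0r, addr0).
Qed.
End Uqso'Relations.

Section Uqso'.
Variables (R : realType) (m : nat).

Definition Uqso'm : Type := palg (@uqso'_rel (Cq R) q_ m).
HB.instance Definition _ := GRing.PzRing.on Uqso'm.
HB.instance Definition _ := GRing.Lmodule.on Uqso'm.

Lemma Uqso'm_neq0 : (1 : Uqso'm) != 0.
Proof.
apply: (@palg_neq0 _ _ _ (Cq R)^o *%R 1 (fun=> 0)).
- exact: mulrA.
- exact: mul1r.
- exact: mulr1.
- exact: mulrDl.
- exact: mulrDr.
- exact: scalerAl.
- exact: scalerAr.
- exact: uqso'_counit_rel.
exact: oner_neq0.
Qed.

HB.instance Definition _ := GRing.PzSemiRing_isNonZero.Build Uqso'm Uqso'm_neq0.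
HB.instance Definition _ :=
  GRing.Lmodule_isLalgebra.Build (Cq R) Uqso'm (@palg_scalerAl _ _ _).
HB.instance Definition _ :=
  GRing.Lalgebra_isAlgebra.Build (Cq R) Uqso'm (@palg_scalerAr _ _ _).

Definition uqB (j : 'I_m.-1) : Uqso'm := pgen _ (GB j).
End Uqso'.

(* The index i + j n of the i-th generator of the j-th block (0-based). *)
Lemma blk_subproof (n m : nat) (i : 'I_n) (j : 'I_m) : (i + j * n < n * m)%N.
Proof.
rewrite [ltnRHS]mulnC (leq_trans (_ : _ < j.+1 * n)%N) //.
  by rewrite mulSn ltn_add2r.
by rewrite leq_mul2r ltn_ord orbT.
Qed.
Definition blk (n m : nat) (i : 'I_n) (j : 'I_m) : 'I_(n * m) :=
  Ordinal (blk_subproof i j).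

Section Lq.
Variables (R : realType) (n m : nat).
Local Notation Cl := (Clq R (n * m)).
Implicit Types (i : 'I_n) (j p : 'I_m).

(* k_{i,p} and its inverse; the first branch is i < n in 1-based indexing *)
Definition kL i p : Cl :=
  if (i.+1 < n)%N then omegaV R (blk i p) * omega R (blk (ordS i) p)
  else q_^-1 *: (omegaV R (blk (ord_pred i) p) * omegaV R (blk i p)).
Definition kLV i p : Cl :=
  if (i.+1 < n)%N then omega R (blk i p) * omegaV R (blk (ordS i) p)
  else q_ *: (omega R (blk (ord_pred i) p) * omega R (blk i p)).

Definition LqK i : Cl := \prod_(p < m) kL i p.
Definition LqE i : Cl :=
  \sum_(j < m) (if (i.+1 < n)%N then psid R (blk i j) * psi R (blk (ordS i) j)
          else psid R (blk (ord_pred i) j) * psid R (blk i j))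
         * \prod_(p < m | (p < j)%N) kL i p.
Definition LqF i : Cl :=
  \sum_(j < m) (\prod_(p < m | (j < p)%N) kLV i p)
         * (if (i.+1 < n)%N then psid R (blk (ordS i) j) * psi R (blk i j)
            else psi R (blk i j) * psi R (blk (ord_pred i) j)).

(* L is the algebra map L_q; the value on K_i^{-1} is forced. *)
Definition is_Lq (L : {lrmorphism Uqso2n R n -> Cl}) : Prop :=
  forall i, [/\ L (uqE R i) = LqE i, L (uqF R i) = LqF i
              & L (uqK R i) = LqK i].
End Lq.

Section Rq.
Variables (R : realType) (n m : nat).
Local Notation Cl := (Clq R (n * m)).
Implicit Types (j : 'I_m.-1) (a b : 'I_n).

(* For j = 0, ..., m-2 the blocks j and j + 1. *)
Definition blk0 j : 'I_m := widen_ord (leq_pred m) j.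
Definition blk1 j : 'I_m := ordS (blk0 j).

Definition kR b j : Cl := omegaV R (blk b (blk0 j)) * omega R (blk b (blk1 j)).
Definition kRV b j : Cl := omega R (blk b (blk0 j)) * omegaV R (blk b (blk1 j)).

Definition rhoE j : Cl :=
  \sum_(b < n) (\prod_(a < n | (b < a)%N) kR a j)
         * (psid R (blk b (blk0 j)) * psi R (blk b (blk1 j))).
Definition rhoF j : Cl :=
  \sum_(b < n) (\prod_(a < n | (a < b)%N) kRV a j)
         * (psid R (blk b (blk1 j)) * psi R (blk b (blk0 j))).
(* rho_q(K_j)^{-1} *)
Definition rhoKV j : Cl := \prod_(a < n) kRV a j.

Definition RqB j : Cl := sqrtN1 *: (rhoF j - q_ *: (rhoKV j * rhoE j)).

Definition is_Rq (Rq : {lrmorphism Uqso'm R m -> Cl}) : Prop :=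
  forall j, Rq (uqB R j) = RqB j.
End Rq.

(* Main.v *)
(* Both maps come from one representation.  For a chain of n fermionic modes the
   root vectors psi^dagger_a psi_b and psi^dagger_a psi^dagger_b satisfy the
   relations of U_q(so_2n), and these relations survive in the q-deformed sum
   over several mutually commuting chains, which is an iterated coproduct.  The
   columns of the n x m grid of modes give L_q.  The rows, of length m, give
   rho_q on the first m - 1 nodes of D_m, which form the diagram of sl_m, and
   F_j - q K_j^-1 E_j then satisfies the relations of U'_q(so_m) up to the sign
   that the square root of -1 absorbs.

   For the commutation write B_j as the sum over the rows b of hop_b times the
   weights of the rows above b, where hop_b moves a particle between the columns
   j and j + 1; this uses the relation q omega + omega^-1 = q + 1, which holds on
   the exterior algebra only.  Since both B_j and the images of E_i and F_i are
   telescoping sums of this kind, only the 2 x 2 block of modes in which the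
   columns j, j + 1 meet the two rows of the i-th root matters, and there the
   claim is an identity in the Clifford algebra of four modes.  Exchanging
   particles and holes reduces F_i to E_i and the node n to the other nodes. *)
From HB Require Import structures.
From mathcomp Require Import all_boot all_order all_algebra reals complex ring zify.
Require Import Defs.
Set Implicit Arguments.
Unset Strict Implicit.
Unset Printing Implicit Defensive.
Import Order.TTheory GRing.Theory Num.Theory.
Local Open Scope ring_scope.
(** * Rewriting in noncommutative polynomials *)

Section WordRewriting.
Variables (F : fieldType) (A : algType F).

Inductive ncexpr :=
| NVar of nat | NZero | NOne | NAdd of ncexpr & ncexpr
| NMul of ncexpr & ncexpr | NOpp of ncexpr | NScale of F & ncexpr.

Definition ncpoly := seq (F * seq nat).

Variable env : seq A.

Fixpoint nceval e : A :=
  match e with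
  | NVar i => nth 0 env i | NZero => 0 | NOne => 1
  | NAdd a b => nceval a + nceval b
  | NMul a b => nceval a * nceval b
  | NOpp a => - nceval a
  | NScale c a => c *: nceval a
  end.

Fixpoint weval (w : seq nat) : A :=
  if w is i :: w' then nth 0 env i * weval w' else 1.

Fixpoint pceval (p : ncpoly) : A :=
  if p is (c, w) :: p' then c *: weval w + pceval p' else 0.

(** The list operations have names of their own so that [ncalg] can unfold exactly these and leave
    the coefficients in F symbolic. *)
Fixpoint pscal (c : F) (p : ncpoly) : ncpoly :=
  if p is (d, w) :: p' then (c * d, w) :: pscal c p' else [::].

Fixpoint papp (p r : ncpoly) : ncpoly :=
  if p is x :: p' then x :: papp p' r else r.

Fixpoint wapp (v w : seq nat) : seq nat :=
  if v is x :: v' then x :: wapp v' w else w.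

Fixpoint pmulw (c : F) (w : seq nat) (p : ncpoly) : ncpoly :=
  if p is (d, v) :: p' then (c * d, wapp w v) :: pmulw c w p' else [::].

Fixpoint pmulp (p r : ncpoly) : ncpoly :=
  if p is (c, w) :: p' then papp (pmulw c w r) (pmulp p' r) else [::].

Fixpoint topoly e : ncpoly :=
  match e with
  | NVar i => [:: (1, [:: i])] | NZero => [::] | NOne => [:: (1, [::])]
  | NAdd a b => papp (topoly a) (topoly b)
  | NMul a b => pmulp (topoly a) (topoly b)
  | NOpp a => pscal (-1) (topoly a)
  | NScale c a => pscal c (topoly a)
  end.

Lemma weval_app v w : weval (wapp v w) = weval v * weval w.
Proof. by elim: v => [|i v IH] /=; rewrite ?mul1r // IH mulrA. Qed.
Lemma pceval_app p r : pceval (papp p r) = pceval p + pceval r.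
Proof. by elim: p => [|[c w] p IH] /=; rewrite ?add0r // IH addrA. Qed.
Lemma pceval_scal c p : pceval (pscal c p) = c *: pceval p.
Proof.
by elim: p => [|[d w] p IH] /=; rewrite ?scaler0 // IH scalerDr scalerA.
Qed.
Lemma pceval_mulw c w p : pceval (pmulw c w p) = c *: weval w * pceval p.
Proof.
elim: p => [|[d v] p IH] /=; first by rewrite mulr0.
by rewrite IH weval_app mulrDr -!scalerAl -!scalerAr !scalerA.
Qed.
Lemma pceval_mul p r : pceval (pmulp p r) = pceval p * pceval r.
Proof.
elim: p => [|[c w] p IH] /=; first by rewrite mul0r.
by rewrite pceval_app pceval_mulw IH mulrDl.
Qed.
Lemma pceval_topoly e : pceval (topoly e) = nceval e.
Proof.
elim: e => //= [i|||||].
- by rewrite addr0 mulr1 scale1r.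
- by rewrite addr0 scale1r.
- by move=> a <- b <-; rewrite pceval_app.
- by move=> a <- b <-; rewrite pceval_mul.
- by move=> a <-; rewrite pceval_scal scaleN1r.
- by move=> c a <-; rewrite pceval_scal.
Qed.

Fixpoint toword e : option (seq nat) :=
  match e with
  | NVar i => Some [:: i] | NOne => Some [::]
  | NMul a b => match toword a, toword b with
                | Some v, Some w => Some (wapp v w) | _, _ => None end
  | _ => None
  end.

Lemma toword_eval e w : toword e = Some w -> weval w = nceval e.
Proof.
elim: e w => //= [i||a IHa b IHb] w; first by case=> <- /=; rewrite mulr1.
  by case=> <-.
case: (toword a) IHa => // v /(_ v erefl) <-.
by case: (toword b) IHb => // u /(_ u erefl) <- [<-]; rewrite weval_app.
Qed.

Definition rules := seq (seq nat * ncpoly).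

Fixpoint mkrules (s : seq (ncexpr * ncexpr)) : rules :=
  match s with
  | [::] => [::]
  | (l, r) :: s' => match toword l with
                    | Some w => (w, topoly r) :: mkrules s'
                    | None => mkrules s' end
  end.

Fixpoint rules_ok (s : seq (ncexpr * ncexpr)) : Prop :=
  if s is (l, r) :: s' then nceval l = nceval r /\ rules_ok s' else True.

Fixpoint valid (rs : rules) : Prop :=
  if rs is (w, p) :: rs' then weval w = pceval p /\ valid rs' else True.

Lemma valid_mkrules s : rules_ok s -> valid (mkrules s).
Proof.
elim: s => [//|[l r] s IH] /= [e /IH v].
case lw: (toword l) => [w|//] /=.
by rewrite (toword_eval lw) pceval_topoly.
Qed.

Fixpoint nateq (i j : nat) : bool :=
  match i, j with
  | O, O => true | S i', S j' => nateq i' j' | _, _ => false end.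
Lemma nateqP i j : nateq i j -> i = j.
Proof. by elim: i j => [|i IH] [|j] //= /IH ->. Qed.

Fixpoint strip (v w : seq nat) : option (seq nat) :=
  match v, w with
  | [::], _ => Some w
  | i :: v', j :: w' => if nateq i j then strip v' w' else None
  | _, _ => None
  end.
Lemma stripP v w u : strip v w = Some u -> weval w = weval v * weval u.
Proof.
elim: v w => [|i v IH] [|j w] //=; try by case=> <-; rewrite mul1r.
case ij: (nateq i j) => // /IH ->.
by rewrite (nateqP ij) mulrA.
Qed.

Fixpoint wsuffix (p : ncpoly) (u : seq nat) : ncpoly :=
  if p is (c, w) :: p' then (c, wapp w u) :: wsuffix p' u else [::].
Lemma pceval_suffix p u : pceval (wsuffix p u) = pceval p * weval u.
Proof.
elim: p => [|[c w] p IH] /=; first by rewrite mul0r.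
by rewrite IH weval_app mulrDl -scalerAl.
Qed.
Fixpoint wcons (i : nat) (p : ncpoly) : ncpoly :=
  if p is (c, w) :: p' then (c, i :: w) :: wcons i p' else [::].
Lemma pceval_cons i p : pceval (wcons i p) = nth 0 env i * pceval p.
Proof.
elim: p => [|[c w] p IH] /=; first by rewrite mulr0.
by rewrite IH mulrDr -scalerAr.
Qed.

Fixpoint rwhead (rs : rules) (w : seq nat) : option ncpoly :=
  if rs is (l, p) :: rs' then
    match strip l w with Some u => Some (wsuffix p u) | None => rwhead rs' w end
  else None.
Lemma rwheadP rs w p : valid rs -> rwhead rs w = Some p -> weval w = pceval p.
Proof.
elim: rs => [//|[l r] rs IH] /= [lr /IH v].
case st: (strip l w) => [u|//] [<-].
by rewrite (stripP st) pceval_suffix lr.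
Qed.

Fixpoint rwword (rs : rules) (w : seq nat) : option ncpoly :=
  match rwhead rs w with
  | Some p => Some p
  | None => if w is i :: w' then
              match rwword rs w' with Some p => Some (wcons i p) | None => None end
            else None
  end.
Lemma rwwordP rs w p : valid rs -> rwword rs w = Some p -> weval w = pceval p.
Proof.
move=> v; elim: w p => [|i w IH] p /=.
  by case h: (rwhead rs [::]) => [r|//] [<-]; rewrite -(rwheadP v h).
case h: (rwhead rs _) => [r|]; first by case=> <-; rewrite -(rwheadP v h).
case: (rwword rs w) IH => // r /(_ r erefl) e [<-].
by rewrite pceval_cons -e.
Qed.

Fixpoint weq (v w : seq nat) : bool :=
  match v, w with
  | [::], [::] => true
  | i :: v', j :: w' => if nateq i j then weq v' w' else false
  | _, _ => false
  end.
Lemma weqP v w : weq v w -> v = w.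
Proof.
by elim: v w => [|i v IH] [|j w] //=; case ij: (nateq i j) => // /IH ->; rewrite (nateqP ij).
Qed.

Fixpoint pins (c : F) (w : seq nat) (p : ncpoly) : ncpoly :=
  match p with
  | [::] => [:: (c, w)]
  | (d, v) :: p' => if weq w v then (c + d, v) :: p' else (d, v) :: pins c w p'
  end.
Lemma pceval_ins c w p : pceval (pins c w p) = c *: weval w + pceval p.
Proof.
elim: p => [//|[d v] p IH] /=.
case wv: (weq w v) => /=; first by rewrite (weqP wv) scalerDl addrA.
by rewrite IH addrCA.
Qed.

(** Every rewriting step preserves the value, so soundness needs neither termination nor confluence
    of the rules; once the fuel is spent the word is kept as it stands. *)
Fixpoint nfw (rs : rules) (fuel : nat) (c : F) (w : seq nat) (acc : ncpoly) :=
  match fuel with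
  | O => pins c w acc
  | S f =>
    match rwword rs w with
    | None => pins c w acc
    | Some p => (fix go (p : ncpoly) (acc : ncpoly) : ncpoly :=
                   if p is (d, v) :: p' then go p' (nfw rs f (c * d) v acc)
                   else acc) p acc
    end
  end.
Lemma pceval_nfw rs fuel c w acc : valid rs ->
  pceval (nfw rs fuel c w acc) = c *: weval w + pceval acc.
Proof.
move=> v; elim: fuel c w acc => [|f IH] c w acc /=; first exact: pceval_ins.
case h: (rwword rs w) => [p|]; last exact: pceval_ins.
rewrite (rwwordP v h) => {h}.
elim: p acc => [|[d u] p IHp] acc /=; first by rewrite scaler0 add0r.
by rewrite IHp IH scalerDr scalerA addrA [_ + c *: pceval p]addrC.
Qed.

Fixpoint nfp (rs : rules) (fuel : nat) (p acc : ncpoly) : ncpoly :=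
  if p is (c, w) :: p' then nfp rs fuel p' (nfw rs fuel c w acc) else acc.
Lemma pceval_nfp rs fuel p acc : valid rs ->
  pceval (nfp rs fuel p acc) = pceval p + pceval acc.
Proof.
move=> v; elim: p acc => [|[c w] p IH] acc /=; first by rewrite add0r.
by rewrite IH pceval_nfw // addrA [pceval p + _]addrC.
Qed.

(** A proposition rather than a boolean: the coefficients are field expressions, whose vanishing is
    left to [ring] or [field]. *)
Fixpoint allzero (p : ncpoly) : Prop :=
  if p is (c, _) :: p' then c = 0 /\ allzero p' else True.
Lemma allzeroP p : allzero p -> pceval p = 0.
Proof. by elim: p => [//|[c w] p IH] /= [-> /IH ->]; rewrite scale0r addr0. Qed.

Lemma ncalg_sound s fuel e1 e2 : rules_ok s ->
  allzero (nfp (mkrules s) fuel (topoly (NAdd e1 (NOpp e2))) [::]) ->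
  nceval e1 = nceval e2.
Proof.
move=> ok /allzeroP; rewrite pceval_nfp; last exact: valid_mkrules.
by rewrite pceval_topoly /= addr0 => /eqP; rewrite subr_eq0 => /eqP.
Qed.
End WordRewriting.

Ltac nc_add x l :=
  lazymatch l with
  | nil => constr:(cons x nil)
  | cons ?y ?l' =>
    match constr:(tt) with
    | _ => let _ := match constr:(tt) with _ => constr_eq x y end in l
    | _ => let r := nc_add x l' in constr:(cons y r)
    end
  end.
Ltac nc_atoms t l :=
  lazymatch t with
  | (?a + ?b)%R => let l1 := nc_atoms a l in nc_atoms b l1
  | (?a * ?b)%R => let l1 := nc_atoms a l in nc_atoms b l1
  | (- ?a)%R => nc_atoms a l
  | (_ *: ?a)%R => nc_atoms a l
  | 0%R => l
  | 1%R => l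
  | _ => nc_add t l
  end.
Ltac nc_index x l :=
  lazymatch l with
  | cons ?y ?l' =>
    match constr:(tt) with
    | _ => let _ := match constr:(tt) with _ => constr_eq x y end in constr:(O)
    | _ => let n := nc_index x l' in constr:(S n)
    end
  end.
Ltac nc_reify F t l :=
  lazymatch t with
  | (?a + ?b)%R => let x := nc_reify F a l in let y := nc_reify F b l in
                   constr:(NAdd x y)
  | (?a * ?b)%R => let x := nc_reify F a l in let y := nc_reify F b l in
                   constr:(NMul x y)
  | (- ?a)%R => let x := nc_reify F a l in constr:(NOpp x)
  | (?c *: ?a)%R => let x := nc_reify F a l in constr:(@NScale F c x)
  | 0%R => constr:(NZero F)
  | 1%R => constr:(NOne F)
  | _ => let n := nc_index t l in constr:(NVar F n)
  end.
Ltac nc_atoms_hyps hs l :=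
  lazymatch hs with
  | (?hs', ?h) => let l1 := nc_atoms_hyps hs' l in nc_atoms_hyps h l1
  | tt => l
  | ?h => lazymatch type of h with
          | ?a = ?b => let l1 := nc_atoms a l in nc_atoms b l1 end
  end.
Ltac nc_rules F hs l acc :=
  lazymatch hs with
  | (?hs', ?h) => let acc1 := nc_rules F h l acc in nc_rules F hs' l acc1
  | tt => acc
  | ?h => lazymatch type of h with
          | ?a = ?b => let x := nc_reify F a l in let y := nc_reify F b l in
                       constr:(cons (x, y) acc) end
  end.
Ltac nc_proofs hs acc :=
  lazymatch hs with
  | (?hs', ?h) => let acc1 := nc_proofs h acc in nc_proofs hs' acc1
  | tt => acc
  | ?h => constr:(conj h acc)
  end.
Ltac nc_conj tac :=
  lazymatch goal with
  | |- True => exact I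
  | |- _ /\ _ => refine (conj _ _); [tac | nc_conj tac]
  end.

(* [ncalg F A hs tac] proves an identity between noncommutative polynomials in
   the F-algebra A by rewriting words with the equations [hs], read from left to
   right (each left-hand side has to be a word); the vanishing of the resulting
   coefficients is left to [tac]. *)
Ltac ncalg F A hs tac :=
  lazymatch goal with
  | |- ?a = ?b =>
    let l0 := constr:(@nil A) in
    let l1 := nc_atoms a l0 in
    let l2 := nc_atoms b l1 in
    let l := nc_atoms_hyps hs l2 in
    let x := nc_reify F a l in
    let y := nc_reify F b l in
    let rs := nc_rules F hs l (@nil (ncexpr F * ncexpr F)) in
    let pf := nc_proofs hs I in
    refine (@ncalg_sound F A l rs 200 x y pf _);
    cbv [allzero nfp nfw pins weq rwword wcons rwhead wsuffix strip nateq mkrules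
         toword topoly pmulp pmulw wapp papp pscal];
    nc_conj tac
  end.

(** * Simple roots and tensor products *)

Section Roots.
Variable n : nat.
Implicit Types i j k : 'I_n.

(* The simple root [i] is e_a + e_b (if [rootT i]) or e_a - e_b, with
   a = [rootA i] and b = [rootB i]. *)
Definition rootT i : bool := (n <= i.+1)%N.
Definition rootA i : 'I_n := if rootT i then ord_pred i else i.
Definition rootB i : 'I_n := if rootT i then i else ordS i.
Definition root_sign i : int := if rootT i then 1 else -1.

Lemma simple_rootE i k :
  simple_root i 0 k = (rootA i == k)%:Z + root_sign i * (rootB i == k)%:Z.
Proof.
rewrite /simple_root /rootA /rootB /root_sign /rootT ltnNge.
by case: (n <= i.+1)%N; rewrite /= !mxE eqxx /= ![k == _]eq_sym; case: (_ == k); case: (_ == k).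
Qed.

Lemma cartanDE i j : cartanD i j =
  (rootA i == rootA j)%:Z + root_sign j * (rootA i == rootB j)%:Z
  + (root_sign i * (rootB i == rootA j)%:Z
     + root_sign i * root_sign j * (rootB i == rootB j)%:Z).
Proof.
have sumD (a : 'I_n) (f : 'I_n -> int) : \sum_k (a == k)%:Z * f k = f a.
  rewrite (bigD1 a) //= eqxx mul1r big1 ?addr0 // => k /negbTE ka.
  by rewrite eq_sym ka mul0r.
rewrite /cartanD; under eq_bigr do rewrite (simple_rootE i) mulrDl -mulrA.
rewrite big_split /= -mulr_sumr !sumD !simple_rootE.
rewrite -(eq_sym (rootA i)) -(eq_sym (rootA i)) -(eq_sym (rootB i)) -(eq_sym (rootB i)).
by rewrite mulrDr !mulrA.
Qed.

Lemma cartanDC i j : cartanD i j = cartanD j i.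
Proof. by apply: eq_bigr => k _; rewrite mulrC. Qed.

Hypothesis hn : (1 < n)%N.

Lemma val_rootA i : rootA i = (if rootT i then n - 2 else i)%N :> nat.
Proof.
rewrite /rootA /rootT; case: leqP => //= h; have := ltn_ord i => hi.
(* Here i = n - 1, and [ord_pred] subtracts 1 modulo n. *)
have -> : (i + n).-1 = (n - 2 + n)%N by lia.
by rewrite modnDr modn_small //; lia.
Qed.
Lemma val_rootB i : rootB i = (if rootT i then n - 1 else i.+1)%N :> nat.
Proof.
rewrite /rootB /rootT; have := ltn_ord i => hi; case: leqP => //= h; first lia.
by rewrite modn_small.
Qed.

Lemma rootAB i : rootA i != rootB i.
Proof.
rewrite -val_eqE /= val_rootA val_rootB /rootT.
by case: leqP; lia.
Qed.

Lemma cartanDii i : cartanD i i = 2.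
Proof.
rewrite cartanDE !eqxx [rootB i == _]eq_sym (negbTE (rootAB i)) !mulr0 !mulr1.
by rewrite /root_sign; case: rootT.
Qed.

Local Ltac fin c ti tj := first [ by rewrite c | by lia | by rewrite ?ti ?tj
  | by apply/eqP; rewrite -val_eqE /= ?val_rootA ?val_rootB ?ti ?tj; lia
  | by rewrite -val_eqE /= ?val_rootA ?val_rootB ?ti ?tj; lia ].

(** Each simple root occupies two adjacent coordinates. Two distinct ones are disjoint, or meet in
    one coordinate, or are the two ends of the fork, which share both coordinates and differ in the
    sign of the second. If they meet in one coordinate, the root in which it comes second has the
    form e_a - e_b. *)
Lemma root_cases i j : i != j ->
  [\/ [/\ rootA i != rootA j, rootA i != rootB j, rootB i != rootA j,
          rootB i != rootB j & cartanD i j = 0],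
      [/\ rootB i = rootA j, rootT i = false, rootA i != rootB j,
          rootB i != rootB j & cartanD i j = -1],
      [/\ rootB j = rootA i, rootT j = false, rootA j != rootB i,
          rootB j != rootB i & cartanD i j = -1]
    | [/\ rootA i = rootA j, rootB i = rootB j, rootT j = ~~ rootT i
        & cartanD i j = 0]].
Proof.
move=> ij; have eqE (a b : 'I_n) : (a == b) = (a == b :> nat) by [].
have nij : i <> j :> nat by move/val_inj => e; rewrite e eqxx in ij.
have hi := ltn_ord i; have hj := ltn_ord j.
have AB := rootAB j; have := cartanDE i j.
rewrite /root_sign !eqE !val_rootA !val_rootB.
case ti: (rootT i); case tj: (rootT j); move: (ti) (tj); rewrite /rootT.
- lia.
- case: (altP (n - 2 =P j)%N) => [e|ne] li lj.
    have -> : (n - 1 == j.+1)%N = true by lia.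
    have -> : (n - 2 == j.+1)%N = false by lia.
    have -> : (n - 1 == j)%N = false by lia.
    by move=> c; constructor 4; split; fin c ti tj.
  have -> : (n - 1 == j.+1)%N = false by lia.
  have -> : (n - 1 == j)%N = false by lia.
  case: (altP (n - 2 =P j.+1)%N) => [e|ne'] c.
    by constructor 3; split; fin c ti tj.
  by constructor 1; split; fin c ti tj.
- move=> li lj.
  case: (altP (i =P n - 2 :> nat)%N) => [e|ne].
    have -> : (i.+1 == n - 1)%N = true by lia.
    have -> : (i.+1 == n - 2)%N = false by lia.
    have -> : (nat_of_ord i == n - 1)%N = false by lia.
    by move=> c; constructor 4; split; fin c ti tj.
  have -> : (i.+1 == n - 1)%N = false by lia.
  have -> : (nat_of_ord i == n - 1)%N = false by lia.
  case: (altP (i.+1 =P n - 2)%N) => [e|ne'] c.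
    by constructor 2; split; fin c ti tj.
  by constructor 1; split; fin c ti tj.
move=> li lj.
have -> : (nat_of_ord i == j) = false by lia.
have -> : (i.+1 == j.+1) = false by lia.
case: (altP (i.+1 =P j :> nat)%N) => [e|ne].
  have -> : (nat_of_ord i == j.+1) = false by lia.
  by move=> c; constructor 2; split; fin c ti tj.
case: (altP (nat_of_ord i =P j.+1)%N) => [e|ne'] c.
  by constructor 3; split; fin c ti tj.
by constructor 1; split; fin c ti tj.
Qed.
End Roots.

(** * Families satisfying the relations of U_q(so_2n), and their coproducts *)

Section Uq.
Variables (F : fieldType) (A : algType F) (q : F).
Hypotheses (q0 : q != 0) (qq0 : q - q^-1 != 0).

(** Working with the images of the generators, not with a morphism out of the quotient, allows
    families to be combined by [tensor] before any morphism is built. *)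
Definition is_uq (n : nat) (X : uqso_gen n -> A) : Prop :=
  forall x y, uqso_rel q x y -> peval *%R 1 X x = peval *%R 1 X y.

Lemma peval_ext (G : Type) (X Y : G -> A) x : X =1 Y ->
  peval *%R 1 X x = peval *%R 1 Y x.
Proof. by move=> XY; elim: x => //= [u -> v ->|u -> v ->]. Qed.

Lemma eq_is_uq n (X Y : uqso_gen n -> A) : X =1 Y -> is_uq X -> is_uq Y.
Proof.
by move=> XY HX x y xy; rewrite -!(peval_ext _ XY); exact: HX.
Qed.

Section Relations.
Variables (n : nat) (X : uqso_gen n -> A).
Hypothesis HX : is_uq X.
Local Notation E i := (X (GE i)).
Local Notation Fg i := (X (GF i)).
Local Notation K i := (X (GK i)).
Local Notation KV i := (X (GKV i)).

Lemma uqKKV i : K i * KV i = 1.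
Proof. by have /= := HX (uqso_KV _ i); rewrite scale1r. Qed.
Lemma uqKVK i : KV i * K i = 1.
Proof. by have /= := HX (uqso_VK _ i); rewrite scale1r. Qed.
Lemma uqKK i j : K i * K j = K j * K i.
Proof. exact: HX (uqso_KK _ i j). Qed.
Lemma uqKVKV i j : KV i * KV j = KV j * KV i.
Proof.
have -> : KV i * KV j = KV i * KV j * (K i * K j) * (KV j * KV i).
  by ncalg F A (uqKKV i, uqKKV j) ltac:(ring).
rewrite (uqKK i j).
by ncalg F A (uqKVK i, uqKVK j) ltac:(ring).
Qed.
Lemma uqKKVC i j : K i * KV j = KV j * K i.
Proof.
have -> : K i * KV j = KV j * (K j * K i) * KV j.
  by ncalg F A (uqKVK j) ltac:(ring).
by rewrite uqKK; ncalg F A (uqKKV j) ltac:(ring).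
Qed.
Lemma uqKE i j : K i * E j = q ^ cartanD i j *: (E j * K i).
Proof.
have /= := HX (uqso_KE _ i j); rewrite -scalerAl mul1r => h.
rewrite scalerAl -h; by ncalg F A (uqKVK i) ltac:(ring).
Qed.
Lemma uqKF i j : K i * Fg j = q ^ (- cartanD i j) *: (Fg j * K i).
Proof.
have /= := HX (uqso_KF _ i j); rewrite -scalerAl mul1r => h.
rewrite scalerAl -h; by ncalg F A (uqKVK i) ltac:(ring).
Qed.
Lemma uqKVE i j : KV i * E j = q ^ (- cartanD i j) *: (E j * KV i).
Proof.
have h : E j * K i = q ^ (- cartanD i j) *: (K i * E j).
  by rewrite uqKE scalerA -expfzDr // addNr expr0z scale1r.
have -> : KV i * E j = KV i * (E j * K i) * KV i.
  by ncalg F A (uqKKV i) ltac:(ring).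
rewrite h; move: (q ^ _) => c.
by ncalg F A (uqKVK i) ltac:(ring).
Qed.
Lemma uqKVF i j : KV i * Fg j = q ^ cartanD i j *: (Fg j * KV i).
Proof.
have h : Fg j * K i = q ^ cartanD i j *: (K i * Fg j).
  by rewrite uqKF scalerA -expfzDr // addrN expr0z scale1r.
have -> : KV i * Fg j = KV i * (Fg j * K i) * KV i.
  by ncalg F A (uqKKV i) ltac:(ring).
rewrite h; move: (q ^ _) => c.
by ncalg F A (uqKVK i) ltac:(ring).
Qed.
Lemma uqEF i : E i * Fg i = Fg i * E i + (q - q^-1)^-1 *: (K i - KV i).
Proof.
have /= := HX (uqso_EF _ i); rewrite -!scalerAl !mul1r !scaleN1r.
by move/eqP; rewrite subr_eq addrC => /eqP.
Qed.
Lemma uqEF0 i j : i != j -> E i * Fg j = Fg j * E i.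
Proof.
move=> ij; have /= := HX (uqso_EF0 _ ij).
by rewrite -!scalerAl !mul1r scale0r scaleN1r => /eqP; rewrite subr_eq0 => /eqP.
Qed.
Lemma uqEE i j : cartanD i j = 0 -> E i * E j = E j * E i.
Proof. by move=> c; exact: HX (uqso_serreE0 _ c). Qed.
Lemma uqFF i j : cartanD i j = 0 -> Fg i * Fg j = Fg j * Fg i.
Proof. by move=> c; exact: HX (uqso_serreF0 _ c). Qed.
Lemma uqEEE i j : cartanD i j = -1 ->
  E i * E i * E j = (q + q^-1) *: (E i * E j * E i) - E j * E i * E i.
Proof.
move=> c; have /= := HX (uqso_serreE1 _ c).
rewrite -!scalerAl !mul1r !scaleN1r scale0r => h.
by rewrite -[LHS]subr0 -h; ncalg F A tt ltac:(ring).
Qed.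
Lemma uqFFF i j : cartanD i j = -1 ->
  Fg i * Fg i * Fg j = (q + q^-1) *: (Fg i * Fg j * Fg i) - Fg j * Fg i * Fg i.
Proof.
move=> c; have /= := HX (uqso_serreF1 _ c).
rewrite -!scalerAl !mul1r !scaleN1r scale0r => h.
by rewrite -[LHS]subr0 -h; ncalg F A tt ltac:(ring).
Qed.
End Relations.

(** The coproduct E -> E ⊗ 1 + K ⊗ E, F -> F ⊗ K^-1 + 1 ⊗ F, K -> K ⊗ K, with X and Y as the two
    tensor factors inside one algebra. *)
Definition tensor n (X Y : uqso_gen n -> A) (t : uqso_gen n) : A :=
  match t with
  | GE i => X (GE i) + X (GK i) * Y (GE i)
  | GF i => X (GF i) * Y (GKV i) + Y (GF i)
  | GK i => X (GK i) * Y (GK i)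
  | GKV i => X (GKV i) * Y (GKV i)
  end.

(** The rules from [C] move the factors from X to the left of those from Y; the relations of X and
    of Y then close each case separately. *)
Lemma tensor_uq n (hn : (1 < n)%N) (X Y : uqso_gen n -> A) : is_uq X -> is_uq Y ->
  (forall s t, Y s * X t = X t * Y s) -> is_uq (tensor X Y).
Proof.
have qq : q ^ 2 = q * q by [].
move=> HX HY C x y; case=> {x y} /= [i|i|i j|i j|i j|i|i j ij|i j c|i j c|i j c|i j c];
  rewrite -?scalerAl ?mul1r ?scaleN1r ?scale0r ?scale1r.
- ncalg F A (uqKKV HX i, uqKKV HY i, C (GK i) (GKV i)) ltac:(ring).
- ncalg F A (uqKVK HX i, uqKVK HY i, C (GKV i) (GK i)) ltac:(ring).
- ncalg F A (uqKK HX i j, uqKK HY i j, C (GK i) (GK j), C (GK j) (GK i)) ltac:(ring).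
- move: (uqKE HX i j) (uqKE HY i j) (uqKK HX i j); move: (q ^ _) => a h1 h2 h3.
  ncalg F A (uqKKV HX i, uqKKV HY i, h1, h2, h3, C (GK i) (GE j), C (GK i) (GKV i),
    C (GE j) (GKV i), C (GK i) (GK j)) ltac:(ring).
- move: (uqKF HX i j) (uqKF HY i j) (uqKKVC HY i j); move: (q ^ _) => a h1 h2 h3.
  ncalg F A (uqKKV HX i, uqKKV HY i, h1, h2, h3, C (GK i) (GF j), C (GK i) (GKV i),
    C (GF j) (GKV i), C (GKV j) (GKV i)) ltac:(ring).
- move: (uqKF HX i i) (uqKVE HY i i) (uqEF HX i) (uqEF HY i).
  move: (q ^ _) (_^-1) => a d h1 h2 h3 h4.
  ncalg F A (h1, h2, h3, h4, C (GE i) (GF i), C (GF i) (GE i), C (GKV i) (GE i),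
   C (GKV i) (GK i), C (GF i) (GK i)) ltac:(ring).
- move: (uqKF HX i j) (uqKVE HY j i) (uqEF0 HX ij) (uqEF0 HY ij).
  rewrite (cartanDC j i); move: (q ^ _) => a h1 h2 h3 h4.
  ncalg F A (h1, h2, h3, h4, C (GE i) (GF j), C (GF j) (GE i), C (GKV j) (GE i),
   C (GKV j) (GK i), C (GF j) (GK i)) ltac:(ring).
- move: (uqKE HX i j) (uqKE HX j i) (uqEE HX c) (uqEE HY c) (uqKK HX i j).
  rewrite (cartanDC j i) c expr0z => h1 h2 h3 h4 h5.
  ncalg F A (h1, h2, h3, h4, h5, C (GE i) (GE j), C (GE j) (GE i), C (GE i) (GK j),
    C (GE j) (GK i)) ltac:(ring).
- move: (uqKE HX i j) (uqKE HX j i) (uqKE HX i i) (uqEEE HX c) (uqEEE HY c) (uqKK HX i j).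
  rewrite (cartanDC j i) c cartanDii // exprN1 qq => h1 h2 h3 h4 h5 h6.
  ncalg F A (h1, h2, h3, h4, h5, h6, C (GE i) (GE j), C (GE j) (GE i), C (GE i) (GE i),
    C (GE i) (GK j), C (GE i) (GK i), C (GE j) (GK i)) ltac:(by field).
- move: (uqKVF HY i j) (uqKVF HY j i) (uqFF HX c) (uqFF HY c) (uqKVKV HY i j).
  rewrite (cartanDC j i) c expr0z => h1 h2 h3 h4 h5.
  ncalg F A (h1, h2, h3, h4, h5, C (GF i) (GF j), C (GF j) (GF i), C (GKV i) (GF j),
    C (GKV j) (GF i)) ltac:(ring).
move: (uqKVF HY i j) (uqKVF HY j i) (uqKVF HY i i) (uqFFF HX c) (uqFFF HY c) (uqKVKV HY i j).
rewrite (cartanDC j i) c cartanDii // exprN1 qq => h1 h2 h3 h4 h5 h6.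
ncalg F A (h1, h2, h3, h4, h5, h6, C (GF i) (GF j), C (GF j) (GF i), C (GF i) (GF i),
  C (GKV j) (GF i), C (GKV i) (GF i), C (GKV i) (GF j)) ltac:(by field).
Qed.

(** The iterated [tensor] in closed form, with the weights placed as in the formulas for L_q;
    [big_tensorS] identifies the two for commuting families. *)
Definition big_tensor n N (X : 'I_N -> uqso_gen n -> A) (t : uqso_gen n) : A :=
  match t with
  | GE i => \sum_(j < N) X j (GE i) * \prod_(p < N | (p < j)%N) X p (GK i)
  | GF i => \sum_(j < N) (\prod_(p < N | (j < p)%N) X p (GKV i)) * X j (GF i)
  | GK i => \prod_(p < N) X p (GK i)
  | GKV i => \prod_(p < N) X p (GKV i)
  end.

Lemma eq_big_tensor n N (X Y : 'I_N -> uqso_gen n -> A) :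
  (forall j, X j =1 Y j) -> big_tensor X =1 big_tensor Y.
Proof.
move=> XY [] i; apply: eq_bigr => j _; rewrite XY //; congr (_ * _);
  by apply: eq_bigr => p _; rewrite XY.
Qed.

Lemma big_tensorS n N (X : 'I_N.+1 -> uqso_gen n -> A) :
  (forall j k s t, j != k -> X j s * X k t = X k t * X j s) ->
  big_tensor X =1
    tensor (big_tensor (fun j => X (widen_ord (leqnSn N) j))) (X ord_max).
Proof.
move=> C [] i /=; rewrite ?big_ord_recr //=.
- congr (_ + _).
    apply: eq_bigr => j _; congr (_ * _).
    rewrite big_mkcond big_ord_recr /= ltnNge (ltnW (ltn_ord j)) mulr1.
    by rewrite -big_mkcond.
  rewrite big_mkcond big_ord_recr /= ltnn mulr1 -big_mkcond /=.
  rewrite (eq_bigl predT) => [|p]; last by rewrite /= ltn_ord.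
  apply: commr_prod => p _; apply: C; rewrite -val_eqE /=.
  by rewrite neq_ltn ltn_ord orbT.
congr (_ + _).
  rewrite mulr_suml; apply: eq_bigr => j _; rewrite -mulrA.
  rewrite big_mkcond big_ord_recr /= ltn_ord -big_mkcond /= -mulrA; congr (_ * _).
  by apply: C; rewrite -val_eqE /= neq_ltn ltn_ord orbT.
rewrite big_pred0 ?mul1r // => p /=.
by rewrite ltnNge -ltnS ltn_ord.
Qed.

Lemma big_tensor_comm n N (X : 'I_N -> uqso_gen n -> A) (Y : uqso_gen n -> A) :
  (forall j s t, Y s * X j t = X j t * Y s) ->
  forall s t, Y s * big_tensor X t = big_tensor X t * Y s.
Proof.
move=> C s [] i /=.
- apply: commr_sum => j _; apply: commrM; first exact: C.
  by apply: commr_prod => p _; exact: C.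
- apply: commr_sum => j _; apply: commrM; last exact: C.
  by apply: commr_prod => p _; exact: C.
- by apply: commr_prod => j _; exact: C.
by apply: commr_prod => j _; exact: C.
Qed.

Lemma big_tensor_uq n N (hn : (1 < n)%N) (X : 'I_N -> uqso_gen n -> A) :
  (forall j, is_uq (X j)) ->
  (forall j k s t, j != k -> X j s * X k t = X k t * X j s) ->
  is_uq (big_tensor X).
Proof.
elim: N X => [|N IH] X HX C.
  (* The empty tensor product is the counit. *)
  apply: (@eq_is_uq _ (fun t => match t with GE _ | GF _ => 0 | _ => 1 end)).
    by case=> i /=; rewrite big_ord0.
  move=> x y; case=> {x y} /= *;
    by rewrite ?(mulr0, mul0r, mulr1, mul1r, addr0, subr0, scale0r, scaler0,
                 scale1r, scaleN1r, subrr).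
apply: eq_is_uq (fun t => esym (big_tensorS C t)) _.
apply: tensor_uq => //.
  apply: IH => // j k s t jk; apply: C; apply: contra jk => /eqP/(congr1 val) /= e.
  exact/eqP/val_inj.
apply: big_tensor_comm => j s t.
by apply: C; rewrite -val_eqE /= neq_ltn ltn_ord orbT.
Qed.

(** * The coideal generators F - q K^-1 E and their deformed Serre relations *)

Section Coideal.
Variables (n : nat) (X : uqso_gen n -> A).
Hypotheses (hn : (1 < n)%N) (HX : is_uq X).

Definition coideal_gen (j : 'I_n) : A :=
  X (GF j) - q *: (X (GKV j) * X (GE j)).

Lemma coideal_far i j : i != j -> cartanD i j = 0 ->
  coideal_gen i * coideal_gen j = coideal_gen j * coideal_gen i.
Proof.
move=> ij c; have ji : j != i by rewrite eq_sym.
have c' : cartanD j i = 0 by rewrite cartanDC.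
move: (uqKVE HX i j) (uqKVE HX j i) (uqKVF HX i j) (uqKVF HX j i)
  (uqKVE HX i i) (uqKVE HX j j).
rewrite c c' oppr0 expr0z !cartanDii //; move: (q ^ _) => a h1 h2 h3 h4 h5 h6.
rewrite /coideal_gen.
ncalg F A (h1, h2, h3, h4, h5, h6, uqEE HX c', uqFF HX c', uqEF0 HX ij, uqEF0 HX ji,
  uqKVKV HX i j) ltac:(ring).
Qed.

(** The quantum Serre relations cancel the terms cubic in E or in F alone; in the mixed terms the
    commutators of E_i with F_i leave a linear remainder, which is minus the generator at j. *)
Lemma coideal_near i j : cartanD i j = -1 ->
  coideal_gen i * coideal_gen i * coideal_gen j
  - (q + q^-1) *: (coideal_gen i * coideal_gen j * coideal_gen i)
  + coideal_gen j * coideal_gen i * coideal_gen i = - coideal_gen j.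
Proof.
move=> c; have ij : i != j by apply/eqP => e; move: c; rewrite e cartanDii.
have ji : j != i by rewrite eq_sym.
have c' : cartanD j i = -1 by rewrite cartanDC.
move: (uqKVE HX i j) (uqKVE HX j i) (uqKVF HX i j) (uqKVF HX j i)
  (uqKVE HX i i) (uqKVF HX i i) (uqKE HX i i) (uqKF HX i i) (uqKE HX i j) (uqKF HX i j)
  (uqKVE HX j j).
have qq : q ^ 2 = q * q by [].
have qqV : q ^ (-2) = (q * q)^-1 by [].
rewrite c c' !cartanDii // opprK exprN1 expr1z qq qqV => h1 h2 h3 h4 h5 h6 h7 h8 h9 h10 h11.
(* The denominator q - q^-1 takes this form once q^-1 is cleared. *)
have q1 : q * q - 1 != 0.
  by have := mulf_neq0 q0 qq0; rewrite mulrBr mulfV.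
rewrite /coideal_gen.
ncalg F A (h1, h2, h3, h4, h5, h6, h7, h8, h9, h10, h11, uqEEE HX c, uqFFF HX c, uqEF HX i, uqEF0 HX ij,
  uqEF0 HX ji, uqKVKV HX i j, uqKVK HX i, uqKKV HX i, uqKKVC HX i j) ltac:(by field; rewrite ?q0 /=).
Qed.
End Coideal.

(** The K^-1 of X cancels the K of X in front of the E of Y, so the second summand carries no factor
    from X. This is the coideal property. *)
Lemma coideal_tensor n (X Y : uqso_gen n -> A) (i : 'I_n) : is_uq X ->
  (forall s t, Y s * X t = X t * Y s) ->
  coideal_gen (tensor X Y) i =
  coideal_gen X i * Y (GKV i) + coideal_gen Y i.
Proof.
move=> HX C; rewrite /coideal_gen /=.
ncalg F A (C (GKV i) (GE i), C (GKV i) (GK i), uqKVK HX i) ltac:(ring).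
Qed.

Lemma coideal_big_tensor n N (hn : (1 < n)%N) (X : 'I_N -> uqso_gen n -> A) (i : 'I_n) :
  (forall j, is_uq (X j)) ->
  (forall j k s t, j != k -> X j s * X k t = X k t * X j s) ->
  coideal_gen (big_tensor X) i =
  \sum_j coideal_gen (X j) i * \prod_(p < N | (j < p)%N) X p (GKV i).
Proof.
elim: N X => [|N IH] X HX C.
  by rewrite /coideal_gen /= !big_ord0 mulr0 scaler0 subr0.
have C' j k s t : j != k -> X (widen_ord (leqnSn N) j) s * X (widen_ord (leqnSn N) k) t
    = X (widen_ord (leqnSn N) k) t * X (widen_ord (leqnSn N) j) s.
  by move=> jk; apply: C; apply: contra jk => /eqP/(congr1 val) /= e; exact/eqP/val_inj.
rewrite [LHS](_ : _ = coideal_gen (tensor (big_tensor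
    (fun j => X (widen_ord (leqnSn N) j))) (X ord_max)) i); last first.
  by rewrite /coideal_gen !(big_tensorS C).
rewrite coideal_tensor; first 1 last.
- by apply: big_tensor_uq.
- have Cm j s t : X ord_max s * X (widen_ord (leqnSn N) j) t =
                X (widen_ord (leqnSn N) j) t * X ord_max s.
    by apply: C; rewrite -val_eqE /= neq_ltn ltn_ord orbT.
  exact: big_tensor_comm.
rewrite IH // big_ord_recr /=; congr (_ + _).
  rewrite mulr_suml; apply: eq_bigr => j _; rewrite -mulrA; congr (_ * _).
  by rewrite [in RHS]big_mkcond big_ord_recr /= ltn_ord -big_mkcond.
rewrite big_pred0 ?mulr1 // => p; by rewrite ltnNge -ltnS ltn_ord.
Qed.
End Uq.

(** * Root vectors in the q-Clifford algebra *)

Section FourFermions.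
Variables (F : fieldType) (A : algType F).
Implicit Types x y z w : A.

Local Notation anti x y := (x * y = - (y * x)) (only parsing).

Lemma anti_pair x y z w : anti x z -> anti x w -> anti y z -> anti y w ->
  x * y * (z * w) = z * w * (x * y).
Proof. by move=> xz xw yz yw; ncalg F A (xz, xw, yz, yw) ltac:(ring). Qed.

Lemma pair_sandwichl x y z w : x * x = 0 -> anti y x -> anti z x -> anti w x ->
  x * y * (z * w) * (x * y) = 0.
Proof. by move=> xx yx zx wx; ncalg F A (xx, yx, zx, wx) ltac:(ring). Qed.

Lemma pair_sandwichr x y z w : y * y = 0 -> anti y x -> anti y z -> anti y w ->
  x * y * (z * w) * (x * y) = 0.
Proof. by move=> yy yx yz yw; ncalg F A (yy, yx, yz, yw) ltac:(ring). Qed.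

Lemma pair_sq x y : x * x = 0 -> anti y x -> x * y * (x * y) = 0.
Proof. by move=> xx yx; ncalg F A (xx, yx) ltac:(ring). Qed.

(** The digits in the names give the positions, among the four factors, of the repeated fermion.
    These products arise from two roots with a common row. *)
Lemma pair_share13 x y w : x * x = 0 -> anti y x -> x * y * (x * w) = 0.
Proof. by move=> xx yx; ncalg F A (xx, yx) ltac:(ring). Qed.
Lemma pair_share24 x y z : y * y = 0 -> anti y z -> x * y * (z * y) = 0.
Proof. by move=> yy yz; ncalg F A (yy, yz) ltac:(ring). Qed.
Lemma pair_share23 x y w : y * y = 0 -> x * y * (y * w) = 0.
Proof. by move=> yy; ncalg F A yy ltac:(ring). Qed.
Lemma pair_share14 x y z : x * x = 0 -> anti y x -> anti z x -> x * y * (z * x) = 0.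
Proof. by move=> xx yx zx; ncalg F A (xx, yx, zx) ltac:(ring). Qed.
End FourFermions.

Section Clifford.
Variables (F : fieldType) (A : algType F) (q : F).
Hypotheses (q0 : q != 0) (qq0 : q - q^-1 != 0) (two0 : 2 != 0 :> F).

Lemma sq_q_neq1 : q * q - 1 != 0.
Proof. by have := mulf_neq0 q0 qq0; rewrite mulrBr mulfV. Qed.

Definition is_clq (p : nat) (M : clq_gen p -> A) : Prop :=
  forall x y, clq_rel q x y -> peval *%R 1 M x = peval *%R 1 M y.

Section Modes.
Variables (p : nat) (M : clq_gen p -> A).
Hypothesis HM : is_clq M.
Implicit Types (a b : 'I_p) (s t : bool).

(* The particle-hole symmetry psi <-> psi^dagger, omega <-> (q omega)^-1
   preserves the relations of one mode; [t = true] is the exchanged mode. *)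
Definition fm t a : A := if t then M (GPsid a) else M (GPsi a).
Definition wm t a : A := if t then q^-1 *: M (GOmegaV a) else M (GOmega a).
Definition wmV t a : A := if t then q *: M (GOmega a) else M (GOmegaV a).

Lemma omV a : M (GOmega a) * M (GOmegaV a) = 1.
Proof. by have /= := HM (clq_omV _ a); rewrite scale1r. Qed.
Lemma Vom a : M (GOmegaV a) * M (GOmega a) = 1.
Proof. by have /= := HM (clq_Vom _ a); rewrite scale1r. Qed.
Lemma omC a b : M (GOmega a) * M (GOmega b) = M (GOmega b) * M (GOmega a).
Proof. exact: HM (clq_omC _ a b). Qed.
Lemma omVC a b : M (GOmega a) * M (GOmegaV b) = M (GOmegaV b) * M (GOmega a).
Proof.
have -> : M (GOmega a) * M (GOmegaV b) =
    M (GOmegaV b) * (M (GOmega b) * M (GOmega a)) * M (GOmegaV b).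
  by ncalg F A (Vom b) ltac:(ring).
by rewrite omC; ncalg F A (omV b) ltac:(ring).
Qed.
Lemma VVC a b : M (GOmegaV a) * M (GOmegaV b) = M (GOmegaV b) * M (GOmegaV a).
Proof.
have -> : M (GOmegaV a) * M (GOmegaV b) =
    M (GOmegaV b) * (M (GOmega b) * M (GOmegaV a)) * M (GOmegaV b).
  by ncalg F A (Vom b) ltac:(ring).
by rewrite omVC; ncalg F A (omV b) ltac:(ring).
Qed.

Lemma wmK t a : wm t a * wmV t a = 1.
Proof.
case: t => /=; last exact: omV.
by ncalg F A (Vom a) ltac:(by field).
Qed.
Lemma wmVK t a : wmV t a * wm t a = 1.
Proof.
case: t => /=; last exact: Vom.
by ncalg F A (omV a) ltac:(by field).
Qed.
Lemma wmC s t a b : wm s a * wm t b = wm t b * wm s a.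
Proof.
case: s; case: t => /=; rewrite -?scalerAl -?scalerAr.
- by rewrite VVC. - by rewrite omVC. - by rewrite omVC. - exact: omC.
Qed.
Lemma wmVC s t a b : wm s a * wmV t b = wmV t b * wm s a.
Proof.
case: s; case: t => /=; rewrite -?scalerAl -?scalerAr ?scalerA 1?[_^-1 * q]mulrC.
- by rewrite omVC. - by rewrite VVC. - by rewrite omC. - exact: omVC.
Qed.
Lemma wmVV s t a b : wmV s a * wmV t b = wmV t b * wmV s a.
Proof.
case: s; case: t => /=; rewrite -?scalerAl -?scalerAr.
- by rewrite omC. - by rewrite omVC. - by rewrite omVC. - exact: VVC.
Qed.

Lemma fm_anti s t a b : a != b -> fm s a * fm t b = - (fm t b * fm s a).
Proof.
move=> ab; have ba : b != a by rewrite eq_sym.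
apply/eqP; rewrite -addr_eq0; case: s; case: t => /=.
- by have /= := HM (clq_pd_pd _ a b); rewrite scale0r => ->.
- by have /= := HM (clq_ps_pd _ ba); rewrite scale0r addrC => ->.
- by have /= := HM (clq_ps_pd _ ab); rewrite scale0r => ->.
- by have /= := HM (clq_ps_ps _ a b); rewrite scale0r => ->.
Qed.
Lemma fm_sq t a : fm t a * fm t a = 0.
Proof.
have h (x : A) : x + x = 0 -> x = 0.
  rewrite -mulr2n -scaler_nat => /(congr1 ( *:%R 2^-1)).
  by rewrite scalerA mulVf // scale1r scaler0.
apply: h; case: t => /=.
  by have /= := HM (clq_pd_pd _ a a); rewrite scale0r.
by have /= := HM (clq_ps_ps _ a a); rewrite scale0r.
Qed.

(** For the exchanged mode, q (q omega)^-1 - q^-1 (q omega) = omega^-1 - omega, so the relation for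
    psi^dagger psi takes the shape of the one for psi psi^dagger. *)
Lemma fm_pair t a : fm t a * fm (~~ t) a =
  (q - q^-1)^-1 *: (q *: wm t a - q^-1 *: wmV t a).
Proof.
case: t => /=.
  have /= := HM (clq_pdps _ a); rewrite -!scalerAl !mul1r !scaleN1r => ->.
  by ncalg F A tt ltac:(by field; rewrite ?q0 ?sq_q_neq1).
have /= := HM (clq_pspd _ a); rewrite -!scalerAl !mul1r !scaleN1r => ->.
by [].
Qed.
Lemma fm_pairN t a : fm (~~ t) a * fm t a = - ((q - q^-1)^-1 *: (wm t a - wmV t a)).
Proof.
case: t => /=.
  have /= := HM (clq_pspd _ a); rewrite -!scalerAl !mul1r !scaleN1r => ->.
  by ncalg F A tt ltac:(ring).
have /= := HM (clq_pdps _ a); rewrite -!scalerAl !mul1r !scaleN1r => ->.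
by [].
Qed.

Definition mode_sign s t : int := if s == t then 1 else -1.

Lemma wm_fm s t a b :
  wm s a * fm t b = q ^ (mode_sign s t * (a == b)%:Z) *: (fm t b * wm s a).
Proof.
have h u : M (GOmega a) * fm u b =
    q ^ (mode_sign false u * (a == b)%:Z) *: (fm u b * M (GOmega a)).
  case: u => /=.
    have /= := HM (clq_om_pd _ a b); rewrite -scalerAl mul1r mulN1r => e.
    by rewrite scalerAl -e; ncalg F A (Vom a) ltac:(ring).
  have /= := HM (clq_om_ps _ a b); rewrite -scalerAl mul1r mul1r => e.
  by rewrite scalerAl -e; ncalg F A (Vom a) ltac:(ring).
case: s => /=; last exact: h.
have -> : mode_sign true t = - mode_sign false t by case: t.
have e := h t; have := expfz_neq0 (mode_sign false t * (a == b)%:Z) q0.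
rewrite mulNr; move: e; rewrite -invr_expz; move: (q ^ _) => c e c0.
(* The relation for omega^-1 comes from the one for omega by inserting omega omega^-1 after the
   fermion. *)
rewrite -[fm t b in LHS](_ : fm t b * M (GOmega a) * M (GOmegaV a) = _); last first.
  by ncalg F A (omV a) ltac:(ring).
have -> : fm t b * M (GOmega a) = c^-1 *: (M (GOmega a) * fm t b).
  by rewrite e scalerA mulVf // scale1r.
by ncalg F A (Vom a, omV a) ltac:(ring).
Qed.

Lemma wmV_fm s t a b :
  wmV s a * fm t b = q ^ (- (mode_sign s t * (a == b)%:Z)) *: (fm t b * wmV s a).
Proof.
have e := wm_fm s t a b; have := expfz_neq0 (mode_sign s t * (a == b)%:Z) q0.
rewrite -invr_expz; move: e; move: (q ^ _) => c e c0.
rewrite -[fm t b in LHS](_ : fm t b * wm s a * wmV s a = _); last first.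
  by ncalg F A (wmK s a) ltac:(ring).
have -> : fm t b * wm s a = c^-1 *: (wm s a * fm t b).
  by rewrite e scalerA mulVf // scale1r.
by ncalg F A (wmVK s a, wmK s a) ltac:(ring).
Qed.

Lemma wm_fmC s t a b : a != b -> wm s a * fm t b = fm t b * wm s a.
Proof. by move=> /negbTE ab; rewrite wm_fm ab mulr0 scale1r. Qed.
Lemma wmV_fmC s t a b : a != b -> wmV s a * fm t b = fm t b * wmV s a.
Proof. by move=> /negbTE ab; rewrite wmV_fm ab mulr0 scale1r. Qed.
End Modes.
Arguments fm {p} M t a : simpl never.
Arguments wm {p} M t a : simpl never.
Arguments wmV {p} M t a : simpl never.

Section RootVectors.
Variables (n : nat) (M : clq_gen n -> A).
Hypotheses (hn : (1 < n)%N) (HM : is_clq M).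
Local Notation fm := (fm M).
Local Notation wm := (wm M).
Local Notation wmV := (wmV M).

(** The flag [rootT i] exchanges particles and holes in the mode [rootB i]. The last node thereby
    becomes the node before it with its second mode exchanged, and the scalar q^-1 of k_{n,p} is the
    one contained in [wm true]. *)
Definition root_vector (g : uqso_gen n) : A :=
  match g with
  | GE i => fm true (rootA i) * fm (rootT i) (rootB i)
  | GF i => fm (~~ rootT i) (rootB i) * fm false (rootA i)
  | GK i => wmV false (rootA i) * wm (rootT i) (rootB i)
  | GKV i => wm false (rootA i) * wmV (rootT i) (rootB i)
  end.

Lemma cartanD_root (i j : 'I_n) : cartanD i j =
  simple_root i 0 (rootA j) + root_sign j * simple_root i 0 (rootB j).
Proof. by rewrite cartanDE !simple_rootE; ring. Qed.

(** The fermions psi^dagger_b and psi_b have weights e_b and -e_b, and K_i pairs the weight with the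
    i-th simple root. Adding weights then gives [root_KE] and [root_KF]. *)
Lemma root_K_fm (i : 'I_n) t b : root_vector (GK i) * fm t b =
  q ^ ((if t then 1 else -1) * simple_root i 0 b) *: (fm t b * root_vector (GK i)).
Proof.
have -> : (if t then 1 else -1) * simple_root i 0 b =
    - (mode_sign false t * (rootA i == b)%:Z)
    + mode_sign (rootT i) t * (rootB i == b)%:Z.
  rewrite simple_rootE /root_sign; case: t; case: (rootT i);
    rewrite /mode_sign /=; ring.
rewrite expfzDr //=; move: (wmV_fm HM false t (rootA i) b) (wm_fm HM (rootT i) t (rootB i) b).
move: (q ^ _) (q ^ _) => c d h1 h2.
by rewrite /=; ncalg F A (h1, h2) ltac:(ring).
Qed.

Lemma root_KKV (i : 'I_n) : root_vector (GK i) * root_vector (GKV i) = 1.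
Proof.
rewrite /=; ncalg F A (wmK HM (rootT i) (rootB i), wmVK HM false (rootA i),
  wmC HM (rootT i) false (rootB i) (rootA i)) ltac:(ring).
Qed.
Lemma root_KVK (i : 'I_n) : root_vector (GKV i) * root_vector (GK i) = 1.
Proof.
rewrite /=; ncalg F A (wmVK HM (rootT i) (rootB i), wmK HM false (rootA i),
  esym (wmVV HM false (rootT i) (rootA i) (rootB i))) ltac:(ring).
Qed.

Lemma root_K_comm (i j : 'I_n) :
  root_vector (GK i) * root_vector (GK j) = root_vector (GK j) * root_vector (GK i).
Proof.
rewrite /=; ncalg F A (wmVV HM false false (rootA i) (rootA j),
  wmVC HM (rootT i) false (rootB i) (rootA j),
  esym (wmVC HM (rootT j) false (rootB j) (rootA i)),
  wmC HM (rootT i) (rootT j) (rootB i) (rootB j)) ltac:(ring).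
Qed.

Lemma root_vector_K (i : 'I_n) (c : int) (x : A) :
  root_vector (GK i) * x = q ^ c *: (x * root_vector (GK i)) ->
  root_vector (GK i) * x * root_vector (GKV i) = q ^ c *: x.
Proof.
by move=> ->; move: (q ^ _) => d; ncalg F A (root_KKV i) ltac:(ring).
Qed.

Lemma root_KE (i j : 'I_n) : root_vector (GK i) * root_vector (GE j) =
  q ^ cartanD i j *: (root_vector (GE j) * root_vector (GK i)).
Proof.
rewrite cartanD_root expfzDr //.
move: (root_K_fm i true (rootA j)) (root_K_fm i (rootT j) (rootB j)).
rewrite mul1r -/(root_sign j); move: (q ^ _) (q ^ _) => c d h1 h2.
by rewrite [root_vector (GE j)]/=; ncalg F A (h1, h2) ltac:(ring).
Qed.
Lemma root_KF (i j : 'I_n) : root_vector (GK i) * root_vector (GF j) =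
  q ^ (- cartanD i j) *: (root_vector (GF j) * root_vector (GK i)).
Proof.
have -> : - cartanD i j = - simple_root i 0 (rootA j)
    + (if ~~ rootT j then 1 else -1) * simple_root i 0 (rootB j).
  by rewrite cartanD_root /root_sign; case: (rootT j) => /=; ring.
rewrite expfzDr //.
move: (root_K_fm i false (rootA j)) (root_K_fm i (~~ rootT j) (rootB j)).
rewrite mulN1r; move: (q ^ _) (q ^ _) => c d h1 h2.
by rewrite [root_vector (GF j)]/=; ncalg F A (h1, h2) ltac:(ring).
Qed.

(** After anticommuting, EF and FE are products of one factor per mode; [fm_pair] and [fm_pairN]
    turn these into polynomials in commuting weights. *)
Lemma root_EF (i : 'I_n) :
  root_vector (GE i) * root_vector (GF i) - root_vector (GF i) * root_vector (GE i)
  = (q - q^-1)^-1 *: (root_vector (GK i) - root_vector (GKV i)).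
Proof.
have AB := rootAB hn i; have BA : rootB i != rootA i by rewrite eq_sym.
move: (fm_pair HM (rootT i) (rootB i)) (fm_pairN HM (rootT i) (rootB i))
  (fm_pairN HM false (rootA i)) (fm_pair HM false (rootA i)).
move=> /= h1 h2 h3 h4.
rewrite /=.
ncalg F A (fm_anti HM (rootT i) true BA, fm_anti HM (~~ rootT i) true BA,
  fm_anti HM (rootT i) false BA, fm_anti HM (~~ rootT i) false BA,
  h1, h2, h3, h4, wm_fmC HM (rootT i) false BA, wmV_fmC HM (rootT i) false BA,
  esym (wm_fmC HM false (~~ rootT i) AB), esym (wmV_fmC HM false (~~ rootT i) AB),
  wmC HM (rootT i) false (rootB i) (rootA i),
  wmVC HM (rootT i) false (rootB i) (rootA i),
  esym (wmVC HM false (rootT i) (rootA i) (rootB i)),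
  wmVV HM (rootT i) false (rootB i) (rootA i)) ltac:(by field; rewrite ?q0 ?sq_q_neq1).
Qed.

(** For disjoint roots the two pairs of fermions commute. If a row is shared, both products contain
    the same fermion twice and vanish. *)
Lemma root_EF0 (i j : 'I_n) : i != j ->
  root_vector (GE i) * root_vector (GF j) = root_vector (GF j) * root_vector (GE i).
Proof.
move=> ij; have ABi := rootAB hn i; have ABj := rootAB hn j.
have sym (a b : 'I_n) : a != b -> b != a by rewrite eq_sym.
rewrite /=; case: (root_cases hn ij) => [[h1 h2 h3 h4 _]|[e t h1 h2 _]|[e t h1 h2 _]|[e1 e2 t _]].
- by apply: anti_pair; apply: fm_anti.
- rewrite t -e pair_share24 ?pair_share24 ?fm_sq //; first exact/fm_anti/sym.
  exact: fm_anti.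
- rewrite t e pair_share13 ?pair_share13 ?fm_sq //; last exact/fm_anti/sym.
  by apply: fm_anti => //; rewrite -e.
rewrite t negbK -e1 -e2 pair_share23 ?fm_sq // pair_share14 ?fm_sq //;
  by apply: fm_anti.
Qed.

Lemma root_serre0 (i j : 'I_n) : cartanD i j = 0 ->
  root_vector (GE i) * root_vector (GE j) = root_vector (GE j) * root_vector (GE i)
  /\ root_vector (GF i) * root_vector (GF j) = root_vector (GF j) * root_vector (GF i).
Proof.
have sym (a b : 'I_n) : a != b -> b != a by rewrite eq_sym.
move=> c; have ij : i != j by apply/eqP => e; move: c; rewrite e cartanDii.
have ABi := rootAB hn i; have ABj := rootAB hn j.
rewrite /=; case: (root_cases hn ij) => [[h1 h2 h3 h4 _]|[e t h1 h2]|[e t h1 h2]|[e1 e2 t _]];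
  rewrite ?c //.
  by split; apply: anti_pair; apply: fm_anti => //.
rewrite -e1 -e2; split.
  by rewrite !pair_share13 ?fm_sq //; exact/fm_anti/sym.
by rewrite !pair_share24 ?fm_sq //; exact/fm_anti.
Qed.

(** For a single chain the Serre relations hold term by term: every monomial in them repeats a
    fermion. *)
Lemma root_serre1 (i j : 'I_n) : cartanD i j = -1 ->
  [/\ root_vector (GE i) * root_vector (GE i) = 0,
      root_vector (GF i) * root_vector (GF i) = 0,
      root_vector (GE i) * root_vector (GE j) * root_vector (GE i) = 0
    & root_vector (GF i) * root_vector (GF j) * root_vector (GF i) = 0].
Proof.
have sym (a b : 'I_n) : a != b -> b != a by rewrite eq_sym.
move=> c; have ij : i != j by apply/eqP => e; move: c; rewrite e cartanDii.
have ABi := rootAB hn i; have ABj := rootAB hn j.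
split; rewrite /=.
- by apply: pair_sq; [exact: fm_sq | exact/fm_anti/sym].
- by apply: pair_sq; [exact: fm_sq | exact/fm_anti].
- case: (root_cases hn ij) => [[_ _ _ _]|[e t h1 h2 _]|[e t h1 h2 _]|[_ _ _]]; rewrite ?c //.
    by apply: pair_sandwichl; rewrite ?fm_sq //; apply/fm_anti/sym; rewrite -?e.
  by apply: pair_sandwichr; rewrite ?fm_sq //; exact/fm_anti/sym.
case: (root_cases hn ij) => [[_ _ _ _]|[e t h1 h2 _]|[e t h1 h2 _]|[_ _ _]]; rewrite ?c //.
  by apply: pair_sandwichr; rewrite ?fm_sq //; apply/fm_anti; rewrite -?e.
by apply: pair_sandwichl; rewrite ?fm_sq //; exact/fm_anti.
Qed.

Lemma root_vector_uq : is_uq q root_vector.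
Proof.
move=> x y; case=> {x y} [i|i|i j|i j|i j|i|i j ij|i j c|i j c|i j c|i j c];
  rewrite [peval]lock /= -lock /= -?scalerAl ?mul1r ?scaleN1r ?scale0r ?scale1r.
- exact: root_KKV.
- exact: root_KVK.
- exact: root_K_comm.
- exact: root_vector_K (root_KE i j).
- exact: root_vector_K (root_KF i j).
- exact: root_EF.
- by apply/eqP; rewrite subr_eq0; apply/eqP; exact: root_EF0.
- exact: (root_serre0 c).1.
- case: (root_serre1 c) => /= h1 _ h2 _.
  by rewrite h1 h2 -[_ * _ * (fm _ _ * _) * _]mulrA h1 mul0r mulr0 scaler0 subr0 addr0.
- exact: (root_serre0 c).2.
case: (root_serre1 c) => /= _ h1 _ h2.
by rewrite h1 h2 -[_ * _ * (fm _ _ * _) * _]mulrA h1 mul0r mulr0 scaler0 subr0 addr0.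
Qed.
End RootVectors.

Definition clq_gen_map n p (phi : 'I_n -> 'I_p) (g : clq_gen n) : clq_gen p :=
  match g with
  | GPsi a => GPsi (phi a) | GPsid a => GPsid (phi a)
  | GOmega a => GOmega (phi a) | GOmegaV a => GOmegaV (phi a)
  end.

Lemma fm_map n p (phi : 'I_n -> 'I_p) (M : clq_gen p -> A) t a :
  fm (M \o clq_gen_map phi) t a = fm M t (phi a).
Proof. by []. Qed.
Lemma wm_map n p (phi : 'I_n -> 'I_p) (M : clq_gen p -> A) t a :
  wm (M \o clq_gen_map phi) t a = wm M t (phi a).
Proof. by []. Qed.
Lemma wmV_map n p (phi : 'I_n -> 'I_p) (M : clq_gen p -> A) t a :
  wmV (M \o clq_gen_map phi) t a = wmV M t (phi a).
Proof. by []. Qed.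

Lemma is_clq_map n p (phi : 'I_n -> 'I_p) (M : clq_gen p -> A) :
  injective phi -> is_clq M -> is_clq (M \o clq_gen_map phi).
Proof.
move=> phiI HM x y [a|a|a b|a b|a b|a b|a b|a b ab|a|a].
- exact: HM (clq_omV _ _).
- exact: HM (clq_Vom _ _).
- exact: HM (clq_omC _ _ _).
- by have /= := HM _ _ (clq_om_ps _ (phi a) (phi b)); rewrite (inj_eq phiI).
- by have /= := HM _ _ (clq_om_pd _ (phi a) (phi b)); rewrite (inj_eq phiI).
- exact: HM (clq_ps_ps _ _ _).
- exact: HM (clq_pd_pd _ _ _).
- by apply: HM _ _ (@clq_ps_pd _ _ _ (phi a) (phi b) _); rewrite (inj_eq phiI).
- exact: HM (clq_pspd _ _).
exact: HM (clq_pdps _ _).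
Qed.

(** All root vectors are even in the fermions, so those built on disjoint sets of modes commute. *)
Lemma root_vector_disjoint n p (phi phi' : 'I_n -> 'I_p) (M : clq_gen p -> A) :
  is_clq M -> (forall a b, phi a != phi' b) -> forall s t,
  root_vector (M \o clq_gen_map phi) s * root_vector (M \o clq_gen_map phi') t =
  root_vector (M \o clq_gen_map phi') t * root_vector (M \o clq_gen_map phi) s.
Proof.
move=> HM dis; have dis' a b : phi' a != phi b by rewrite eq_sym.
have EE x y z w (a b c d : 'I_n) :
   fm M x (phi a) * fm M y (phi b) * (fm M z (phi' c) * fm M w (phi' d)) =
   fm M z (phi' c) * fm M w (phi' d) * (fm M x (phi a) * fm M y (phi b)).
  by apply: anti_pair; apply: fm_anti.
have C1 (x y u v : A) : GRing.comm x u -> GRing.comm x v -> GRing.comm y u ->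
    GRing.comm y v -> x * y * (u * v) = u * v * (x * y).
  by move=> xu xv yu yv; apply/commrM; apply/commr_sym/commrM; apply/commr_sym.
move=> [] i [] j; rewrite /root_vector !(fm_map, wm_map, wmV_map);
  first [exact: EE | apply: C1; first
   [ exact: (wmC HM) | exact: (wmVC HM) | exact/commr_sym/(wmVC HM)
   | exact: (wmVV HM) | exact: (wm_fmC HM) | exact: (wmV_fmC HM)
   | exact/commr_sym/(wm_fmC HM) | exact/commr_sym/(wmV_fmC HM)]].
Qed.
End Clifford.
Arguments fm {F A p} M t a : simpl never.
Arguments wm {F A} q {p} M t a : simpl never.
Arguments wmV {F A} q {p} M t a : simpl never.

(** * Existence of the two maps *)

Section CommutingProducts.
Variables (A : pzRingType) (I : finType) (F : I -> A).
Hypothesis FC : forall i j, F i * F j = F j * F i.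

(** Only the factors commute, not the ring; a permutation is reduced to exchanges of two
    segments. *)
Lemma prodr_perm (P : pred I) (s t : seq I) : perm_eq s t ->
  \prod_(i <- s | P i) F i = \prod_(i <- t | P i) F i.
Proof.
apply: (catCA_perm_subst (F := fun s => \prod_(i <- s | P i) F i)) => u v w.
rewrite /= !big_cat /= !mulrA; congr (_ * _); apply: commr_prod => i _.
by apply/commr_sym/commr_prod => j _; exact: FC.
Qed.

Lemma prodr_reindex (h : I -> I) (P : pred I) : injective h ->
  \prod_(i | P i) F i = \prod_(i | P (h i)) F (h i).
Proof.
move=> hI; rewrite (@prodr_perm _ _ (map h (index_enum I))) ?big_map //.
apply: uniq_perm; rewrite ?map_inj_uniq ?index_enum_uniq //.
move=> i; rewrite mem_index_enum; apply/esym/mapP.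
by exists (invF hI i); rewrite ?f_invF // mem_index_enum.
Qed.

Lemma prodrD1 (j : I) (P : pred I) : P j ->
  \prod_(i | P i) F i = F j * \prod_(i | P i && (i != j)) F i.
Proof.
move=> Pj; have /prodr_perm -> := perm_to_rem (mem_index_enum j).
rewrite big_cons Pj; congr (_ * _).
rewrite (rem_filter j (index_enum_uniq I)) big_filter_cond.
by apply: eq_bigl => i; rewrite andbC.
Qed.
End CommutingProducts.

Section PresentedMorphism.
Variables (F : fieldType) (G : Type) (rel : pexpr F G -> pexpr F G -> Prop).
Variables (A : algType F) (g : G -> A).
Hypothesis grel : forall x y, rel x y -> peval *%R 1 g x = peval *%R 1 g y.
Local Ltac alg := first [ exact: mulrA | exact: mul1r | exact: mulr1
  | exact: mulrDl | exact: mulrDr | exact: scalerAl | exact: scalerAr | exact: grel ].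

Lemma plift_linear : linear (plift (rel := rel) *%R 1 g).
Proof. by move=> a u v; rewrite pliftD ?pliftZ //; alg. Qed.

Lemma plift_monoid : monoid_morphism (plift (rel := rel) *%R 1 g).
Proof. by split=> [|u v]; [apply: plift1 | apply: pliftM]; alg. Qed.

Lemma plift_pgen t : plift (rel := rel) *%R 1 g (pgen rel t) = g t.
Proof. by apply: plift_gen; alg. Qed.
End PresentedMorphism.

Section Existence.
Variable R : realType.
Local Notation q := (@q_ R).
Local Notation q0 := (q_neq0 R).
Local Notation qq0 := (qqV_neq0 R).

Lemma two_neq0 : 2 != 0 :> Cq R.
Proof.
rewrite -(rmorph_nat (@tofrac {poly R[i]}) 2) tofrac_eq0.
by rewrite -polyC_natr polyC_eq0 pnatr_eq0.
Qed.

Definition clq_pgen p (g : clq_gen p) : Clq R p := pgen _ g.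

Lemma clq_pgen_is_clq p : is_clq q (@clq_pgen p).
Proof.
have ev x : peval *%R 1 (@clq_pgen p) x = pclass _ x :> Clq R p.
  elim: x => //= [a|x -> y ->|x -> y ->].
  - by rewrite pclass_const.
  - by rewrite pclassD.
  - by rewrite pclassM.
by move=> x y xy; rewrite !ev; apply/pclassP/pcong_rel.
Qed.

Section Grid.
Variables (n m : nat).

Lemma blk_inj (i i' : 'I_n) (p p' : 'I_m) :
  blk i p = blk i' p' -> i = i' /\ p = p'.
Proof.
move=> /(congr1 val) /= e.
have d (a : 'I_n) (b : 'I_m) : ((a + b * n) %/ n = b)%N.
  by rewrite addnC divnMDl ?divn_small ?addn0 // (leq_ltn_trans _ (ltn_ord a)).
have r (a : 'I_n) (b : 'I_m) : ((a + b * n) %% n = a)%N.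
  by rewrite addnC modnMDl modn_small.
split; apply: val_inj => /=; first by rewrite -(r i p) e r.
by rewrite -(d i p) e d.
Qed.

Variables (A : algType (Cq R)) (M : clq_gen (n * m) -> A).

Definition column (p : 'I_m) : clq_gen n -> A := M \o clq_gen_map (fun i => blk i p).
Definition row (b : 'I_n) : clq_gen m -> A := M \o clq_gen_map (blk b).

Definition Lq_gen : uqso_gen n -> A :=
  big_tensor (fun p => root_vector q (column p)).
(* The coproduct orders the rows downwards, hence the reversal. *)
Definition rho_gen : uqso_gen m -> A :=
  big_tensor (fun b => root_vector q (row (rev_ord b))).

Hypothesis HM : is_clq q M.

Lemma Lq_gen_uq : (1 < n)%N -> is_uq q Lq_gen.
Proof.
move=> hn; apply: big_tensor_uq => //; first exact: q0.
  move=> p; apply: root_vector_uq => //; [exact: q0|exact: qq0|exact: two_neq0|].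
  by apply: is_clq_map => // i i' /blk_inj[].
move=> p p' s t pp'; apply: root_vector_disjoint => //; first exact: q0.
by move=> a b; apply: contra pp' => /eqP/blk_inj[_ ->].
Qed.

Lemma rho_gen_uq : (1 < m)%N -> is_uq q rho_gen.
Proof.
move=> hm; apply: big_tensor_uq => //; first exact: q0.
  move=> b; apply: root_vector_uq => //; [exact: q0|exact: qq0|exact: two_neq0|].
  by apply: is_clq_map => // i i' /blk_inj[].
move=> b b' s t bb'; apply: root_vector_disjoint => //; first exact: q0.
by move=> a c; apply: contra bb' => /eqP/blk_inj[/rev_ord_inj -> _].
Qed.
End Grid.

Section Formulas.
Variables (n m : nat).
Local Notation M := (@clq_pgen (n * m)).

Lemma kLE (i : 'I_n) (p : 'I_m) : kL R i p = root_vector q (column M p) (GK i).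
Proof.
rewrite /= !(wm_map, wmV_map) /wm /wmV /kL /rootA /rootB /rootT [(_.+1 < n)%N]ltnNge.
by case: leqP => //= _; rewrite scalerAr.
Qed.
Lemma kLVE (i : 'I_n) (p : 'I_m) : kLV R i p = root_vector q (column M p) (GKV i).
Proof.
rewrite /= !(wm_map, wmV_map) /wm /wmV /kLV /rootA /rootB /rootT [(_.+1 < n)%N]ltnNge.
by case: leqP => //= _; rewrite scalerAr.
Qed.

Lemma LqE_gen (i : 'I_n) : LqE R m i = Lq_gen M (GE i).
Proof.
apply: eq_bigr => j _; congr (_ * _).
  rewrite /= !fm_map /rootA /rootB /rootT [(_.+1 < n)%N]ltnNge; by case: leqP.
by apply: eq_bigr => p _; rewrite kLE.
Qed.
Lemma LqF_gen (i : 'I_n) : LqF R m i = Lq_gen M (GF i).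
Proof.
apply: eq_bigr => j _; congr (_ * _).
  by apply: eq_bigr => p _; rewrite kLVE.
rewrite /= !fm_map /rootA /rootB /rootT [(_.+1 < n)%N]ltnNge; by case: leqP.
Qed.
Lemma LqK_gen (i : 'I_n) : LqK R m i = Lq_gen M (GK i).
Proof. by apply: eq_bigr => p _; rewrite kLE. Qed.

Lemma rootT_blk0 (j : 'I_m.-1) : rootT (blk0 j) = false.
Proof.
by apply/negbTE; rewrite /rootT -ltnNge /=; case: m j => [|k] j; [case: j|rewrite ltnS].
Qed.
Lemma rootA_blk0 (j : 'I_m.-1) : rootA (blk0 j) = blk0 j.
Proof. by rewrite /rootA rootT_blk0. Qed.
Lemma rootB_blk0 (j : 'I_m.-1) : rootB (blk0 j) = blk1 j.
Proof. by rewrite /rootB rootT_blk0. Qed.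
Let blk0E := (rootT_blk0, rootA_blk0, rootB_blk0).

Lemma kRE (b : 'I_n) (j : 'I_m.-1) : kR R b j = root_vector q (row M b) (GK (blk0 j)).
Proof. by rewrite /= !blk0E. Qed.
Lemma kRVE (b : 'I_n) (j : 'I_m.-1) : kRV R b j = root_vector q (row M b) (GKV (blk0 j)).
Proof. by rewrite /= !blk0E. Qed.

Lemma kR_comm (a b : 'I_n) (j : 'I_m.-1) : kR R a j * kR R b j = kR R b j * kR R a j.
Proof.
have [->//|ab] := eqVneq a b.
rewrite !kRE; apply: root_vector_disjoint; [exact: q0 | exact: clq_pgen_is_clq |].
by move=> p p'; apply: contra ab => /eqP/blk_inj[-> _].
Qed.
Lemma kRV_comm (a b : 'I_n) (j : 'I_m.-1) : kRV R a j * kRV R b j = kRV R b j * kRV R a j.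
Proof.
have [->//|ab] := eqVneq a b.
rewrite !kRVE; apply: root_vector_disjoint; [exact: q0 | exact: clq_pgen_is_clq |].
by move=> p p'; apply: contra ab => /eqP/blk_inj[-> _].
Qed.

(** Reversing the rows turns the condition a > b into p < b. The weights, which stand on the left in
    [rhoE] and on the right in [big_tensor], belong to other rows than the root vector and move past
    it. *)
Lemma rhoE_gen (j : 'I_m.-1) : rhoE R n j = rho_gen M (GE (blk0 j)).
Proof.
rewrite /rhoE (reindex_inj rev_ord_inj) /=; apply: eq_bigr => b _.
rewrite (prodr_reindex (fun a c => kR_comm a c j) _ rev_ord_inj) /=.
rewrite (eq_bigl (fun p : 'I_n => (p < b)%N)) => [|p]; last by rewrite ltn_sub2lE // ltnS.
have -> : psid R (blk (rev_ord b) (blk0 j)) * psi R (blk (rev_ord b) (blk1 j))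
   = root_vector q (row M (rev_ord b)) (GE (blk0 j)) by rewrite /= !blk0E.
under eq_bigr do rewrite kRE.
apply/commr_sym/commr_prod => p pb; apply: root_vector_disjoint.
- exact: q0.
- exact: clq_pgen_is_clq.
by move=> a c; apply/eqP => /blk_inj[/rev_ord_inj e _]; move: pb; rewrite e ltnn.
Qed.
Lemma rhoF_gen (j : 'I_m.-1) : rhoF R n j = rho_gen M (GF (blk0 j)).
Proof.
rewrite /rhoF (reindex_inj rev_ord_inj) /=; apply: eq_bigr => b _.
rewrite (prodr_reindex (fun a c => kRV_comm a c j) _ rev_ord_inj) /=.
rewrite (eq_bigl (fun p : 'I_n => (b < p)%N)) => [|p]; last by rewrite ltn_sub2lE // ltnS.
by under eq_bigr do rewrite kRVE; rewrite /= !blk0E.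
Qed.
Lemma rhoKV_gen (j : 'I_m.-1) : rhoKV R n j = rho_gen M (GKV (blk0 j)).
Proof.
rewrite /rhoKV (prodr_reindex (fun a c => kRV_comm a c j) _ rev_ord_inj) /=.
by apply: eq_bigr => b _; rewrite kRVE.
Qed.
Lemma RqB_gen (j : 'I_m.-1) :
  RqB R n j = sqrtN1 *: coideal_gen q (rho_gen M) (blk0 j).
Proof. by rewrite /RqB rhoE_gen rhoF_gen rhoKV_gen. Qed.

Lemma blk0_blk1 (j : 'I_m.-1) : blk1 j = (blk0 j).+1 :> nat.
Proof.
rewrite /= modn_small //; have := ltn_ord j.
by case: m j => [|l] j //=; rewrite ltnS.
Qed.

(** On the nodes [blk0] the matrix of D_m is the Cartan matrix of sl_m. *)
Lemma cartanD_blk0 (j k : 'I_m.-1) : cartanD (blk0 j) (blk0 k) =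
  (j == k)%:Z *+ 2 - (j == k.+1 :> nat)%:Z - (k == j.+1 :> nat)%:Z.
Proof.
have eqE (a b : 'I_m) : (a == b) = (a == b :> nat) by [].
rewrite cartanDE /root_sign !blk0E !eqE !blk0_blk1 -val_eqE /=.
by rewrite eqSS [_.+1 == _]eq_sym; ring.
Qed.

Lemma RqB_rel (hm : (1 < m)%N) x y : uqso'_rel q x y ->
  peval *%R 1 (fun t : uqso'_gen m => let: GB j := t in RqB R n j) x =
  peval *%R 1 (fun t : uqso'_gen m => let: GB j := t in RqB R n j) y.
Proof.
have HX := rho_gen_uq (@clq_pgen_is_clq (n * m)) hm.
have := sqrtN1_sq R; rewrite expr2 => ss.
case=> {x y} [i j ij|j k jk] /=; rewrite !RqB_gen.
  have ne : blk0 i != blk0 j by rewrite -val_eqE /=; lia.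
  have c : cartanD (blk0 i) (blk0 j) = 0.
    rewrite cartanD_blk0 -val_eqE /=.
    have -> : (nat_of_ord i == j) = false by lia.
    have -> : (nat_of_ord i == j.+1) = false by lia.
    by have -> : (nat_of_ord j == i.+1) = false by lia.
  have := coideal_far q0 hm HX ne c; move: (coideal_gen _ _ _) (coideal_gen _ _ _) => b b' h.
  by ncalg (Cq R) (Clq R (n * m)) h ltac:(ring).
have c : cartanD (blk0 j) (blk0 k) = -1.
  rewrite cartanD_blk0 -val_eqE /=.
  have -> : (nat_of_ord j == k) = false by lia.
  case/orP: jk => /eqP ->; rewrite eqxx.
    by have -> : (nat_of_ord j == j.+2) = false by lia.
  by have -> : (nat_of_ord k == k.+2) = false by lia.
have := coideal_near q0 qq0 hm HX c.
move: (coideal_gen _ _ _) (coideal_gen _ _ _) => b' b h.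
move: sqrtN1 ss => s ss.
(* The left side is cubic and the right side linear in the generators, so s^3 = -s turns the minus
   sign of [coideal_near] into a plus. *)
transitivity ((s * s * s) *: (b * b * b' - (q + q^-1) *: (b * b' * b) + b' * b * b)).
  by ncalg (Cq R) (Clq R (n * m)) tt ltac:(ring).
by rewrite h ss mulN1r scalerN scaleNr opprK.
Qed.

End Formulas.

(** The proof [HX] is an argument so that the morphism structures can be attached to the
    function. *)
Definition uqso_lift n (A : algType (Cq R)) (X : uqso_gen n -> A)
  (HX : is_uq q X) : Uqso2n R n -> A := plift *%R 1 X.
HB.instance Definition _ n (A : algType (Cq R)) (X : uqso_gen n -> A)
    (HX : is_uq q X) :=
  GRing.isLinear.Build _ _ _ _ (uqso_lift HX) (plift_linear HX).
HB.instance Definition _ n (A : algType (Cq R)) (X : uqso_gen n -> A)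
    (HX : is_uq q X) :=
  GRing.isMonoidMorphism.Build _ _ (uqso_lift HX) (plift_monoid HX).

Lemma Lq_exists n m : (1 < n)%N ->
  exists L : {lrmorphism Uqso2n R n -> Clq R (n * m)}, is_Lq L.
Proof.
move=> hn; have HX := Lq_gen_uq (@clq_pgen_is_clq (n * m)) hn.
exists (uqso_lift HX : {lrmorphism Uqso2n R n -> Clq R (n * m)}) => i.
by rewrite LqE_gen LqF_gen LqK_gen; split; exact: plift_pgen HX _.
Qed.

Definition uqso'_lift m (A : algType (Cq R)) (X : uqso'_gen m -> A)
  (HX : forall x y, uqso'_rel q x y -> peval *%R 1 X x = peval *%R 1 X y) :
  Uqso'm R m -> A := plift *%R 1 X.
HB.instance Definition _ m (A : algType (Cq R)) (X : uqso'_gen m -> A) HX :=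
  GRing.isLinear.Build _ _ _ _ (@uqso'_lift m A X HX) (plift_linear HX).
HB.instance Definition _ m (A : algType (Cq R)) (X : uqso'_gen m -> A) HX :=
  GRing.isMonoidMorphism.Build _ _ (@uqso'_lift m A X HX) (plift_monoid HX).

Lemma Rq_exists n m : (1 < m)%N ->
  exists Rq : {lrmorphism Uqso'm R m -> Clq R (n * m)}, is_Rq Rq.
Proof.
move=> hm; have HX := @RqB_rel n m hm.
exists (uqso'_lift HX : {lrmorphism Uqso'm R m -> Clq R (n * m)}) => j.
exact: plift_pgen HX _.
Qed.
End Existence.

(** * Commutation on the exterior algebra *)

Section Ladder.
Variables (A : pzRingType) (N : nat) (e k : 'I_N -> A) (c d : 'I_N) (z : A).
Hypotheses (cd : d = c.+1 :> nat)
  (kk : forall i j, k i * k j = k j * k i)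
  (ek : forall i j, i != j -> e i * k j = k j * e i)
  (ze : forall i, i != c -> i != d -> GRing.comm z (e i))
  (zk : forall i, i != c -> i != d -> GRing.comm z (k i))
  (zkk : (d.+1 < N)%N -> GRing.comm z (k c * k d))
  (zek : GRing.comm z (e c + k c * e d)).

(* Apart from c and d, only k c * k d occurs in the summands to the right of d,
   and the summands at c and d add up to (e c + k c * e d) times factors to the
   left of c. *)
Lemma ladder_comm : GRing.comm z (\sum_i e i * \prod_(j < N | (j < i)%N) k j).
Proof.
have dc : d != c by rewrite -val_eqE /= cd neq_ltn ltnSn orbT.
rewrite (bigD1 c) //= (bigD1 d) //= addrA; apply: commrD.
  rewrite (@prodrD1 _ _ _ kk c (fun j : 'I_N => (j < d)%N)) ?cd //.
  have -> : \prod_(i < N | (i < c.+1)%N && (i != c)) k i = \prod_(i < N | (i < c)%N) k i.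
    by apply: eq_bigl => j; rewrite -val_eqE /=; lia.
  rewrite [e d * _]mulrA ek // -mulrDl; apply: commrM => //.
  apply: commr_prod => j jc; apply: zk; rewrite -val_eqE /= ?cd; lia.
apply: commr_sum => i /andP[ic id]; apply: commrM; first exact: ze.
have [lic|lci] := ltnP i c.
  by apply: commr_prod => j ji; apply: zk; rewrite -val_eqE /= ?cd; lia.
have ldi : (d < i)%N.
  by move: ic id; rewrite -!val_eqE /= cd; lia.
rewrite (@prodrD1 _ _ _ kk c (fun j : 'I_N => (j < i)%N)) ?(leq_trans _ ldi) ?cd //.
rewrite (@prodrD1 _ _ _ kk d) ?ldi // mulrA; apply: commrM.
  by apply: zkk; apply: leq_ltn_trans ldi _.
by apply: commr_prod => j /andP[/andP[_ jc] jd]; apply: zk.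
Qed.
End Ladder.

Section FourModes.
Variables (F : fieldType) (A : algType F) (q : F).
Hypothesis q0 : q != 0.
Variables (c1 c2 c3 c4 d1 d2 d3 d4 : A).
Local Notation car x y := (x * x = 0 /\ y * y = 0 /\ y * x = 1 - x * y) (only parsing).
Local Notation far x y x' y' := [/\ x' * x = - (x * x'), x' * y = - (y * x'),
  y' * x = - (x * y') & y' * y = - (y * y')] (only parsing).
Hypotheses (H1 : car c1 d1) (H2 : car c2 d2) (H3 : car c3 d3) (H4 : car c4 d4)
 (H12 : far c1 d1 c2 d2) (H13 : far c1 d1 c3 d3) (H14 : far c1 d1 c4 d4)
 (H23 : far c2 d2 c3 d3) (H24 : far c2 d2 c4 d4) (H34 : far c3 d3 c4 d4).
Local Notation w x y := (x * y + q^-1 *: (y * x)).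
Local Notation v x y := (x * y + q *: (y * x)).

(** Modes 1, 2, 3, 4 stand for (a, c), (b, c), (a, d), (b, d), with rows a, b and columns c, d. The
    weights [w] and [v] are written through the fermions, so both sides are polynomials in eight
    undeformed fermions and normal ordering decides the identity. *)
Lemma four_modes :
  (d1 * c2 + v c1 d1 * w c2 d2 * (d3 * c4)) *
  (d3 * c1 - d1 * c3 + w c1 d1 * v c3 d3 * (d4 * c2 - d2 * c4)) =
  (d3 * c1 - d1 * c3 + w c1 d1 * v c3 d3 * (d4 * c2 - d2 * c4)) *
  (d1 * c2 + v c1 d1 * w c2 d2 * (d3 * c4)).
Proof.
case: H1 H2 H3 H4 => a1 [a2 a3] [b1 [b2 b3]] [e1 [e2 e3]] [f1 [f2 f3]].
case: H12 H13 H14 H23 H24 H34 => x1 x2 x3 x4 [y1 y2 y3 y4] [z1 z2 z3 z4]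
  [u1 u2 u3 u4] [v1 v2 v3 v4] [w1 w2 w3 w4].
ncalg F A (a1, a2, a3, b1, b2, b3, e1, e2, e3, f1, f2, f3, x1, x2, x3, x4,
  y1, y2, y3, y4, z1, z2, z3, z4, u1, u2, u3, u4, v1, v2, v3, v4, w1, w2, w3, w4)
  ltac:(by field).
Qed.
End FourModes.

(** * Hops along the rows against root vectors along the columns *)

Section Commutation.
Variables (F : fieldType) (A : algType F) (q : F).
Hypotheses (q0 : q != 0) (qq0 : q - q^-1 != 0) (two0 : 2 != 0 :> F).
Variables (n m : nat) (M : clq_gen (n * m) -> A).
Hypothesis HM : is_clq q M.
Local Notation fm := (fm M).
Local Notation wm := (wm q M).
Local Notation wmV := (wmV q M).

(* This holds on the exterior algebra, where omega has the eigenvalues 1 and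
   q^-1, but not in the q-Clifford algebra. *)
Hypothesis om_eigen : forall a,
  q *: M (GOmega a) + M (GOmegaV a) = (q + 1) *: 1.

Lemma wm_eigen t a : q *: wm t a + wmV t a = (q + 1) *: 1.
Proof.
case: t => /=; rewrite -(om_eigen a) ?scalerA ?mulfV ?scale1r //.
by rewrite addrC.
Qed.

Lemma wmVE t a : wmV t a = (q + 1) *: 1 - q *: wm t a.
Proof. by rewrite -(wm_eigen t a) addrC addKr. Qed.

(** The sum of [fm_pair] and [fm_pairN] is (q omega + omega^-1) / (q + 1), so the eigenvalue
    relation restores the undeformed anticommutator. *)
Lemma fm_car t a : fm (~~ t) a * fm t a = 1 - fm t a * fm (~~ t) a.
Proof.
rewrite (fm_pair q0 qq0 HM) (fm_pairN HM) wmVE.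
by ncalg F A tt ltac:(by field; rewrite ?q0 ?sq_q_neq1).
Qed.
(** The spectral decomposition of the weight: the two products of fermions are the complementary
    projections to the eigenvalues 1 and q^-1. *)
Lemma wm_fermion t a :
  wm t a = fm t a * fm (~~ t) a + q^-1 *: (fm (~~ t) a * fm t a).
Proof.
rewrite (fm_pair q0 qq0 HM) (fm_pairN HM) wmVE.
by ncalg F A tt ltac:(by field; rewrite ?q0 ?sq_q_neq1).
Qed.
Lemma wmV_fermion t a :
  wmV t a = fm t a * fm (~~ t) a + q *: (fm (~~ t) a * fm t a).
Proof.
rewrite (fm_pair q0 qq0 HM) (fm_pairN HM) wmVE.
by ncalg F A tt ltac:(by field; rewrite ?q0 ?sq_q_neq1).
Qed.

Lemma wm_fm_id t a : wm t a * fm t a = fm t a.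
Proof.
rewrite wm_fermion.
ncalg F A (fm_sq two0 HM t a, fm_car t a) ltac:(ring).
Qed.
Lemma wmV_fm_id t a : wmV t a * fm t a = fm t a.
Proof. by rewrite -[in LHS](wm_fm_id t a) mulrA (wmVK q0 HM) mul1r. Qed.
Lemma wm_fmN t a : wm t a * fm (~~ t) a = q^-1 *: fm (~~ t) a.
Proof.
rewrite wm_fermion.
ncalg F A (fm_sq two0 HM (~~ t) a, fm_car t a) ltac:(ring).
Qed.

Implicit Types (a b : 'I_n) (p c d : 'I_m) (s t : bool).

Definition hop b c d : A :=
  fm true (blk b d) * fm false (blk b c) - fm true (blk b c) * fm false (blk b d).

Lemma hop_mode t b c d : c != d ->
  hop b c d = fm (~~ t) (blk b d) * fm t (blk b c)
            - fm (~~ t) (blk b c) * fm t (blk b d).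
Proof.
move=> cd; case: t; rewrite /hop //=.
have ne : blk b c != blk b d by apply: contra cd => /eqP/blk_inj[_ ->].
have ne' : blk b d != blk b c by rewrite eq_sym.
by ncalg F A (fm_anti HM true false ne, fm_anti HM true false ne') ltac:(ring).
Qed.

Lemma blk_row a b c d : a != b -> blk a c != blk b d.
Proof. by apply: contra => /eqP/blk_inj[-> _]. Qed.
Lemma blk_col a b c d : c != d -> blk a c != blk b d.
Proof. by apply: contra => /eqP/blk_inj[_ ->]. Qed.

Lemma fm_pairs_comm s t s' t' (x y x' y' : 'I_(n * m)) :
  x != x' -> x != y' -> y != x' -> y != y' ->
  GRing.comm (fm s x * fm t y) (fm s' x' * fm t' y').
Proof. by move=> *; apply: anti_pair; apply: (fm_anti HM). Qed.

Lemma pair_hop s t x y b c d :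
  x != blk b c -> x != blk b d -> y != blk b c -> y != blk b d ->
  GRing.comm (fm s x * fm t y) (hop b c d).
Proof. by move=> *; apply: commrB; apply: fm_pairs_comm. Qed.

Lemma wm_hop t x b c d : x != blk b c -> x != blk b d ->
  GRing.comm (wm t x) (hop b c d).
Proof.
by move=> *; apply: commrB; apply: commrM; apply: (wm_fmC q0 HM).
Qed.
Lemma wmV_hop t x b c d : x != blk b c -> x != blk b d ->
  GRing.comm (wmV t x) (hop b c d).
Proof.
by move=> *; apply: commrB; apply: commrM; apply: (wmV_fmC q0 HM).
Qed.

(** A hop preserves the total particle number of its row in the columns c and d. *)
Lemma wm2_hop t a b c d : c != d ->
  GRing.comm (wm t (blk a c) * wm t (blk a d)) (hop b c d).
Proof.
move=> cd; have dc : d != c by rewrite eq_sym.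
have [->|ab] := eqVneq a b; last first.
  by apply/commr_sym/commrM; apply/commr_sym/wm_hop; apply: blk_row.
rewrite (hop_mode t b cd).
have cd' := blk_col b b cd; have dc' := blk_col b b dc.
move: (wm_fm q0 HM t t (blk b c) (blk b c)) (wm_fm q0 HM t (~~ t) (blk b c) (blk b c))
 (wm_fm q0 HM t t (blk b d) (blk b d)) (wm_fm q0 HM t (~~ t) (blk b d) (blk b d)).
rewrite /mode_sign !eqxx [t == ~~ t](_ : _ = false) ?mulr1; last by case: t.
rewrite exprN1 expr1z => h1 h2 h3 h4; rewrite /GRing.comm.
ncalg F A (h1, h2, h3, h4, wm_fmC q0 HM t t cd', wm_fmC q0 HM t t dc',
  wm_fmC q0 HM t (~~ t) cd', wm_fmC q0 HM t (~~ t) dc') ltac:(by field).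
Qed.
Lemma wmV2_hop t a b c d : c != d ->
  GRing.comm (wmV t (blk a c) * wmV t (blk a d)) (hop b c d).
Proof.
move=> cd; have dc : d != c by rewrite eq_sym.
have [->|ab] := eqVneq a b; last first.
  by apply/commr_sym/commrM; apply/commr_sym/wmV_hop; apply: blk_row.
rewrite (hop_mode t b cd).
have cd' := blk_col b b cd; have dc' := blk_col b b dc.
move: (wmV_fm q0 HM t t (blk b c) (blk b c)) (wmV_fm q0 HM t (~~ t) (blk b c) (blk b c))
 (wmV_fm q0 HM t t (blk b d) (blk b d)) (wmV_fm q0 HM t (~~ t) (blk b d) (blk b d)).
rewrite /mode_sign !eqxx [t == ~~ t](_ : _ = false) ?mulr1; last by case: t.
rewrite opprK exprN1 expr1z => h1 h2 h3 h4; rewrite /GRing.comm.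
ncalg F A (h1, h2, h3, h4, wmV_fmC q0 HM t t cd', wmV_fmC q0 HM t t dc',
  wmV_fmC q0 HM t (~~ t) cd', wmV_fmC q0 HM t (~~ t) dc') ltac:(by field).
Qed.

(** Next to the fermions the weights become scalars: omega psi^dagger = q^-1 psi^dagger and omega^-1
    psi = psi, which cancels the factor q. *)
Lemma hop_coideal b c d : c != d ->
  fm true (blk b d) * fm false (blk b c)
  - q *: (wm false (blk b c) * wmV false (blk b d)
          * (fm true (blk b c) * fm false (blk b d))) = hop b c d.
Proof.
move=> cd; have dc : d != c by rewrite eq_sym.
move: (wm_fmN false (blk b c)) => /= h; rewrite /hop.
ncalg F A (wmV_fmC q0 HM false true (blk_col b b dc), wmV_fm_id false (blk b d), h)
  ltac:(by field).
Qed.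

Section Pair.
Variables (t1 t2 : bool) (a b : 'I_n).
Hypothesis ab : a != b.

(* With a and b the rows of the i-th root, (t1, t2) = (false, rootT i) gives the
   summands of L_q(E_i), and (true, ~~ rootT i) those of - L_q(F_i), for which
   the columns have to be taken in reverse order. *)
Definition col_e p : A := fm (~~ t1) (blk a p) * fm t2 (blk b p).
Definition col_k p : A := wmV t1 (blk a p) * wm t2 (blk b p).

Lemma col_row_step c d : c != d ->
  GRing.comm (col_e c + col_k c * col_e d)
    (hop a c d + wm t1 (blk a c) * wmV t1 (blk a d) * hop b c d).
Proof.
move=> cd; have dc : d != c by rewrite eq_sym.
have ba : b != a by rewrite eq_sym.
have H u x : fm u x * fm u x = 0 /\ fm (~~ u) x * fm (~~ u) x = 0
   /\ fm (~~ u) x * fm u x = 1 - fm u x * fm (~~ u) x.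
  by rewrite !(fm_sq two0 HM); split=> //; split=> //; exact: fm_car.
have far u u' x y : x != y ->
  [/\ fm u' y * fm u x = - (fm u x * fm u' y),
      fm u' y * fm (~~ u) x = - (fm (~~ u) x * fm u' y),
      fm (~~ u') y * fm u x = - (fm u x * fm (~~ u') y)
    & fm (~~ u') y * fm (~~ u) x = - (fm (~~ u) x * fm (~~ u') y)].
  by move=> xy; split; apply: (fm_anti HM); rewrite eq_sym.
(* Each hop is written with the flag of its own row, which makes all values of the flags instances
   of the same identity. *)
rewrite (hop_mode t1 a cd) (hop_mode t2 b cd).
rewrite /col_e /col_k (wm_fermion t1) (wm_fermion t2) !(wmV_fermion t1).
apply: four_modes => //; by [exact: H | apply: far; first [exact: blk_row | exact: blk_col]].
Qed.

Definition row_k c d b' : A := wm t1 (blk b' c) * wmV t1 (blk b' d).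
(* For t1 = false and c, d = j, j + 1 this is B_j up to the scalar sqrt(-1). *)
Definition row_sum c d : A :=
  \sum_(b' < n) hop b' c d * \prod_(a' < n | (a' < b')%N) row_k c d a'.

Local Ltac wcomm := first [ exact: (wmC HM) | exact: (wmVC HM)
  | exact/commr_sym/(wmVC HM) | exact: (wmVV HM) ].
Local Ltac split4 := apply/commrM; apply/commr_sym/commrM; apply/commr_sym.

Lemma row_k_comm c d b' p : GRing.comm (row_k c d b') (col_k p).
Proof. by split4; wcomm. Qed.
Lemma row_kk c d b' c' d' a' : row_k c d b' * row_k c' d' a' = row_k c' d' a' * row_k c d b'.
Proof. by split4; wcomm. Qed.
Lemma col_kk p p' : col_k p * col_k p' = col_k p' * col_k p.
Proof. by split4; wcomm. Qed.

Lemma col_ek p p' : p != p' -> col_e p * col_k p' = col_k p' * col_e p.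
Proof.
move=> pp; have pp' : p' != p by rewrite eq_sym.
by split4; apply/commr_sym; first [apply: (wm_fmC q0 HM) | apply: (wmV_fmC q0 HM)];
  apply: blk_col.
Qed.

Lemma row_ek c d b' a' : b' != a' -> hop b' c d * row_k c d a' = row_k c d a' * hop b' c d.
Proof.
rewrite eq_sym => ne; apply: commrM; apply/commr_sym; [apply: wm_hop | apply: wmV_hop];
  exact: blk_row.
Qed.

Lemma col_e_hop p b' c d : p != c -> p != d -> GRing.comm (col_e p) (hop b' c d).
Proof. by move=> *; apply: pair_hop; apply: blk_col. Qed.
Lemma col_k_hop p b' c d : p != c -> p != d -> GRing.comm (col_k p) (hop b' c d).
Proof.
move=> *; apply/commr_sym/commrM; apply/commr_sym; [apply: wmV_hop | apply: wm_hop];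
  by apply: blk_col.
Qed.
Lemma col_e_hop_row p b' c d : b' != a -> b' != b -> GRing.comm (col_e p) (hop b' c d).
Proof. by rewrite ![b' == _]eq_sym => *; apply: pair_hop; apply: blk_row. Qed.
Lemma col_k_hop_row p b' c d : b' != a -> b' != b -> GRing.comm (col_k p) (hop b' c d).
Proof.
rewrite ![b' == _]eq_sym => *; apply/commr_sym/commrM; apply/commr_sym;
  [apply: wmV_hop | apply: wm_hop]; by apply: blk_row.
Qed.
Lemma col_e_row_k p b' c d : p != c -> p != d -> GRing.comm (col_e p) (row_k c d b').
Proof.
move=> pc pd; split4; apply/commr_sym;
  first [apply: (wm_fmC q0 HM) | apply: (wmV_fmC q0 HM)]; apply: blk_col; by rewrite eq_sym.
Qed.
Lemma col_e_row_k_row p b' c d : b' != a -> b' != b -> GRing.comm (col_e p) (row_k c d b').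
Proof.
move=> pc pd; split4; apply/commr_sym;
  first [apply: (wm_fmC q0 HM) | apply: (wmV_fmC q0 HM)]; by apply: blk_row.
Qed.

Lemma col_kk_hop b' c d : c != d -> GRing.comm (col_k c * col_k d) (hop b' c d).
Proof.
move=> cd.
have -> : col_k c * col_k d = (wmV t1 (blk a c) * wmV t1 (blk a d)) *
    (wm t2 (blk b c) * wm t2 (blk b d)).
  by rewrite /col_k !mulrA -[_ * wm t2 _ * wmV _ _]mulrA (wmVC HM) !mulrA.
by apply/commr_sym/commrM; apply/commr_sym; [apply: wmV2_hop | apply: wm2_hop].
Qed.

(** With equal flags [col_e p] transfers one particle, or one hole, between the rows a and b of one
    column, so the weights taken over both rows together do not change. *)
Lemma col_e_row_kk p c d : t2 = t1 -> GRing.comm (col_e p) (row_k c d a * row_k c d b).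
Proof.
move=> t12.
have E (x : 'I_n) (p1 p2 : 'I_m) : (blk x p1 == blk x p2) = (p1 == p2).
  by apply/eqP/eqP => [/blk_inj[]|->].
have ba : b != a by rewrite eq_sym.
rewrite /col_e /row_k t12.
move: (wm_fm q0 HM t1 (~~ t1) (blk a c) (blk a p)) (wm_fm q0 HM t1 t1 (blk b c) (blk b p))
  (wmV_fm q0 HM t1 (~~ t1) (blk a d) (blk a p)) (wmV_fm q0 HM t1 t1 (blk b d) (blk b p))
  (wm_fmC q0 HM t1 t1 (blk_row c p ab)) (wm_fmC q0 HM t1 (~~ t1) (blk_row c p ba))
  (wmV_fmC q0 HM t1 t1 (blk_row d p ab)) (wmV_fmC q0 HM t1 (~~ t1) (blk_row d p ba)).
rewrite /mode_sign eqxx [t1 == ~~ t1](_ : _ = false); last by case: (t1).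
rewrite !E; case: (c == p); case: (d == p);
  rewrite ?mulr0 ?mulr1 ?oppr0 ?opprK ?expr0z ?exprN1 ?expr1z => h1 h2 h3 h4 h5 h6 h7 h8;
  rewrite /GRing.comm; by ncalg F A (h1, h2, h3, h4, h5, h6, h7, h8) ltac:(by field).
Qed.

Hypothesis ba1 : b = a.+1 :> nat.
Hypothesis last_or_same : (b.+1 < n)%N -> t2 = t1.

(** The weights of the columns c and d are taken together, because only their product commutes with
    the hops. *)
Lemma col_prod_rows (c d : 'I_m) : c != d ->
  GRing.comm (row_sum c d) (\prod_p col_k p).
Proof.
move=> cd; rewrite (prodrD1 col_kk (j := c)) // (prodrD1 col_kk (j := d)) /=; last first.
  by rewrite eq_sym.
rewrite mulrA; apply: commrM.
  apply/commr_sym/commr_sum => i _; apply: commrM; first exact: col_kk_hop.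
  by apply: commr_prod => j _; apply/commr_sym/commrM; exact: row_k_comm.
apply: commr_prod => p /andP[pc pd].
apply/commr_sym/commr_sum => i _; apply: commrM; first exact: col_k_hop.
by apply: commr_prod => j _; exact/commr_sym/row_k_comm.
Qed.

(** The ladder argument along the rows, with a and b as the two special indices. A row beyond b
    excludes the last node, the only one with different flags, so [col_e_row_kk] is available where
    it is needed. *)
Lemma col_step_rows c d : c != d ->
  GRing.comm (col_e c + col_k c * col_e d) (row_sum c d).
Proof.
move=> cd; have DE x : GRing.comm (col_e c) x -> GRing.comm (col_k c) x ->
    GRing.comm (col_e d) x -> GRing.comm (col_e c + col_k c * col_e d) x.
  move=> h1 h2 h3; apply/commr_sym/commrD; first exact/commr_sym.
  by apply: commrM; apply/commr_sym.
apply: (ladder_comm ba1).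
- by move=> i j; exact: row_kk.
- exact: row_ek.
- move=> i ia ib; apply: DE; [exact: col_e_hop_row|exact: col_k_hop_row|exact: col_e_hop_row].
- move=> i ia ib; apply: DE; last exact: col_e_row_k_row.
    exact: col_e_row_k_row.
  exact/commr_sym/row_k_comm.
- move=> /last_or_same t12; apply: DE; [exact: col_e_row_kk| |exact: col_e_row_kk].
  by apply: commrM; exact/commr_sym/row_k_comm.
exact: col_row_step.
Qed.

(** The ladder argument a second time, along the columns. The map [sg] is the identity for E_i and
    the reversal for F_i. *)
Lemma col_sum_rows (sg : 'I_m -> 'I_m) (c d : 'I_m) : injective sg -> d = c.+1 :> nat ->
  GRing.comm (row_sum (sg c) (sg d))
    (\sum_p col_e (sg p) * \prod_(p' < m | (p' < p)%N) col_k (sg p')).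
Proof.
move=> sgI dc1.
have cd : sg c != sg d by rewrite (inj_eq sgI) -val_eqE /= dc1; lia.
have R x : (forall b', GRing.comm x (hop b' (sg c) (sg d))) ->
    (forall b', GRing.comm x (row_k (sg c) (sg d) b')) ->
    GRing.comm (row_sum (sg c) (sg d)) x.
  move=> h1 h2; apply/commr_sym/commr_sum => i _; apply: commrM; first exact: h1.
  by apply: commr_prod => j _; exact: h2.
apply: (ladder_comm dc1) => [i j|i j ij|i ic id|i ic id|_|].
- exact: col_kk.
- by apply: col_ek; rewrite (inj_eq sgI).
- by apply: R => b'; [apply: col_e_hop | apply: col_e_row_k]; rewrite (inj_eq sgI).
- apply: R => b'; last exact/commr_sym/row_k_comm.
  by apply: col_k_hop; rewrite (inj_eq sgI).
- apply: R => b'; first exact: col_kk_hop.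
  by apply/commr_sym/commrM; exact: row_k_comm.
exact/commr_sym/col_step_rows.
Qed.
End Pair.

(** The hop is antisymmetric in c and d, while exchanging the modes inverts the weights up to
    scalars q and q^-1 that cancel. *)
Lemma row_sum_swap c d : row_sum true d c = - row_sum false c d.
Proof.
rewrite /row_sum -sumrN; apply: eq_bigr => b _.
rewrite -mulNr /hop opprB; congr (_ * _); apply: eq_bigr => a _.
rewrite /row_k /= -scalerAl -scalerAr scalerA mulVf // scale1r.
exact: (esym (omVC HM _ _)).
Qed.
End Commutation.

(** * Commutation of the images of the generators *)

Section Duality.
Variables (R : realType) (n m : nat).
Hypotheses (hn : (1 < n)%N) (hm : (1 < m)%N).
Local Notation q := (@q_ R).
Local Notation q0 := (q_neq0 R).
Local Notation qq0 := (qqV_neq0 R).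
Local Notation two0 := (two_neq0 R).
Variables (A : algType (Cq R)) (M : clq_gen (n * m) -> A).
Hypotheses (HM : is_clq q M)
  (om_eigen : forall a, q *: M (GOmega a) + M (GOmegaV a) = (q + 1) *: 1).
Implicit Types (i : 'I_n) (j : 'I_m.-1).

Lemma blk01_neq j : blk0 j != blk1 j.
Proof. by rewrite -val_eqE [val (blk1 j)]blk0_blk1 /= neq_ltn ltnSn. Qed.

Lemma coideal_row b j :
  coideal_gen q (root_vector q (row M b)) (blk0 j) = hop M b (blk0 j) (blk1 j).
Proof.
rewrite /coideal_gen /root_vector rootT_blk0 rootA_blk0 rootB_blk0.
rewrite !(fm_map, wm_map, wmV_map).
exact: (hop_coideal q0 qq0 two0 HM om_eigen _ (blk01_neq j)).
Qed.

Lemma coideal_rho j :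
  coideal_gen q (rho_gen M) (blk0 j) = row_sum q M false (blk0 j) (blk1 j).
Proof.
rewrite (coideal_big_tensor q0) //; first last.
- move=> b b' s t bb'; apply: root_vector_disjoint => //; first exact: q0.
  by move=> a c; apply: contra bb' => /eqP/blk_inj[/rev_ord_inj -> _].
- move=> b; apply: root_vector_uq => //; [exact: q0|exact: qq0|exact: two0|].
  by apply: is_clq_map => // i i' /blk_inj[].
rewrite /row_sum (reindex_inj rev_ord_inj) /=; apply: eq_bigr => b _.
rewrite coideal_row rev_ordK; congr (_ * _).
have rC (a a' : 'I_n) := row_kk HM false (blk0 j) (blk1 j) a (blk0 j) (blk1 j) a'.
rewrite (prodr_reindex rC (fun a : 'I_n => (a < b)%N) rev_ord_inj).
apply: eq_big => [a|a _]; first by have := ltn_ord a; have := ltn_ord b; rewrite /=; lia.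
by rewrite /root_vector rootT_blk0 rootA_blk0 rootB_blk0 !(wm_map, wmV_map).
Qed.

Let rootB_S i : rootB i = (rootA i).+1 :> nat.
Proof. by rewrite val_rootA // val_rootB //; case: rootT; lia. Qed.
Let rootT_last i : ((rootB i).+1 < n)%N -> rootT i = false.
Proof. by rewrite val_rootB //; case: rootT => //; lia. Qed.

Lemma Lq_genE i : Lq_gen M (GE i) =
  \sum_p col_e M false (rootT i) (rootA i) (rootB i) p
         * \prod_(p' < m | (p' < p)%N) col_k q M false (rootT i) (rootA i) (rootB i) p'.
Proof. by []. Qed.

(** Swapping the two fermions of F_i costs the sign and yields [col_e] in exchanged modes, and k^-1
    is [col_k] in those modes. Reversing the columns turns the product over p > j into one over
    smaller indices. *)
Lemma Lq_genF i : Lq_gen M (GF i) =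
  - \sum_p col_e M true (~~ rootT i) (rootA i) (rootB i) (rev_ord p)
     * \prod_(p' < m | (p' < p)%N)
         col_k q M true (~~ rootT i) (rootA i) (rootB i) (rev_ord p').
Proof.
have AB := rootAB hn i.
pose k p := col_k q M true (~~ rootT i) (rootA i) (rootB i) p.
have kE p : root_vector q (column M p) (GKV i) = k p.
  rewrite /= !(wm_map, wmV_map) /k /col_k; case: (rootT i); rewrite /wm /wmV /=;
    by rewrite -?scalerAl -?scalerAr ?scalerA ?mulVf ?mulfV ?q0 ?scale1r.
have kC p p' : k p * k p' = k p' * k p by exact: col_kk.
rewrite [LHS](reindex_inj rev_ord_inj) -sumrN; apply: eq_bigr => p _.
have -> : root_vector q (column M (rev_ord p)) (GF i) =
    - col_e M true (~~ rootT i) (rootA i) (rootB i) (rev_ord p).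
  by rewrite /= !fm_map /col_e (fm_anti HM) // blk_row // eq_sym.
rewrite mulrN; congr (- _).
rewrite (eq_bigr k) => [|p' _]; last exact: kE.
rewrite (prodr_reindex kC _ rev_ord_inj).
rewrite (eq_bigl (fun p' : 'I_m => (p' < p)%N)) => [|p']; last first.
  by have := ltn_ord p; have := ltn_ord p'; rewrite /=; lia.
apply/commr_sym/commr_prod => p' lt; apply: (col_ek q0 HM).
by rewrite (inj_eq rev_ord_inj) -val_eqE /= neq_ltn lt orbT.
Qed.

Let Lq_genK i j :
  GRing.comm (row_sum q M false (blk0 j) (blk1 j)) (Lq_gen M (GK i)).
Proof. exact: (col_prod_rows q0 HM false (rootT i) (rootA i) (rootB i) (blk01_neq j)). Qed.

Lemma Lq_rho_comm j g :
  GRing.comm (coideal_gen q (rho_gen M) (blk0 j)) (Lq_gen M g).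
Proof.
rewrite coideal_rho; case: g => i.
- rewrite Lq_genE.
  exact: (col_sum_rows q0 qq0 two0 HM om_eigen (rootAB hn i) (rootB_S i)
    (@rootT_last i) (sg := id) (fun _ _ e => e) (blk0_blk1 j)).
- rewrite Lq_genF; apply: commrN.
  (* Under reversal the column j + 1 comes just before the column j, so the two change roles in the
     ladder. *)
  have e : rev_ord (blk0 j) = (rev_ord (blk1 j)).+1 :> nat.
    by have := blk0_blk1 j; have := ltn_ord (blk1 j); rewrite /=; lia.
  have last : ((rootB i).+1 < n)%N -> ~~ rootT i = true by move=> /rootT_last ->.
  have := col_sum_rows q0 qq0 two0 HM om_eigen (rootAB hn i) (rootB_S i)
    last rev_ord_inj e.
  rewrite !rev_ordK (row_sum_swap q0 HM) => h.
  by rewrite -[row_sum _ _ _ _ _]opprK; apply/commr_sym/commrN/commr_sym.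
- exact: Lq_genK.
(* An element that commutes with K_i commutes with its inverse. *)
have HX := Lq_gen_uq HM hn.
have := Lq_genK i j; move: (row_sum _ _ _ _ _) => x xK.
rewrite /GRing.comm -[x in LHS]mul1r -(uqKVK HX i) -[_ * x]mulrA -xK.
by rewrite -!mulrA (uqKKV HX i) mulr1.
Qed.
End Duality.

Lemma comm_scale (F : fieldType) (A : algType F) (c : F) (x y : A) :
  GRing.comm x y -> GRing.comm (c *: x) y.
Proof. by move=> xy; rewrite /GRing.comm -scalerAl xy scalerAr. Qed.

(** * Transport of the formulas along an algebra morphism *)

Section Transport.
Variables (F : fieldType) (A B : algType F) (phi : {lrmorphism A -> B}) (q : F).

Lemma fm_morph p (M : clq_gen p -> A) t a : phi (fm M t a) = fm (phi \o M) t a.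
Proof. by case: t. Qed.
Lemma wm_morph p (M : clq_gen p -> A) t a : phi (wm q M t a) = wm q (phi \o M) t a.
Proof. by case: t; rewrite //= linearZ. Qed.
Lemma wmV_morph p (M : clq_gen p -> A) t a : phi (wmV q M t a) = wmV q (phi \o M) t a.
Proof. by case: t; rewrite //= linearZ. Qed.

Lemma root_vector_morph n (M : clq_gen n -> A) g :
  phi (root_vector q M g) = root_vector q (phi \o M) g.
Proof.
by case: g => i; rewrite /= rmorphM /= ?fm_morph ?wm_morph ?wmV_morph.
Qed.

Lemma big_tensor_morph n N (X : 'I_N -> uqso_gen n -> A) g :
  phi (big_tensor X g) = big_tensor (fun j t => phi (X j t)) g.
Proof.
case: g => i; rewrite /= ?rmorph_sum ?rmorph_prod //=;
  by apply: eq_bigr => j _; rewrite ?rmorphM ?rmorph_prod.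
Qed.

Lemma coideal_gen_morph n (X : uqso_gen n -> A) i :
  phi (coideal_gen q X i) = coideal_gen q (phi \o X) i.
Proof. by rewrite /coideal_gen linearB /= linearZ /= rmorphM. Qed.

Lemma eq_coideal_gen n (X Y : uqso_gen n -> A) i : X =1 Y ->
  coideal_gen q X i = coideal_gen q Y i.
Proof. by move=> XY; rewrite /coideal_gen !XY. Qed.
End Transport.

Section ExtEnd.
Variables (F : fieldType) (p : nat).

(** On an empty mode the two terms are q and 1, on an occupied one they are 1 and q. *)
Lemma gen_act_om_eigen (q : F) (a : 'I_p) : q != 0 ->
  q *: gen_act q (GOmega a) + gen_act q (GOmegaV a) = (q + 1) *: \1%VF.
Proof.
move=> q0; apply: endext_eq => l.
rewrite !(add_lfunE, scale_lfunE, id_lfunE, lin_extE) scalerA -scalerDl.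
congr (_ *: _); case: (l a); rewrite ?oppr0 ?expr0z ?exprN1 ?expr1z.
  by rewrite mulfV // addrC.
by rewrite mulr1.
Qed.

(** A copy of the endomorphism space with composition as its product, so that [ext_act] becomes an
    algebra morphism. *)
Definition ext_end : Type := 'End(ext F p).
HB.instance Definition _ := GRing.Lmodule.on ext_end.

Lemma ext_end1_neq0 : (\1%VF : ext_end) != 0.
Proof.
apply/eqP => h; have /eqP := vbasis_neq0 F ([ffun=> false] : bits p); apply.
by rewrite -[LHS]id_lfunE h zero_lfunE.
Qed.

HB.instance Definition _ := GRing.Zmodule_isNzRing.Build ext_end
  (@comp_lfunA _ _ _ _ _) (@comp_lfun1l _ _ _) (@comp_lfun1r _ _ _)
  (@comp_lfunDl _ _ _ _) (@comp_lfunDr _ _ _ _) ext_end1_neq0.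
HB.instance Definition _ := GRing.Lmodule_isLalgebra.Build F ext_end
  (fun k (f g : ext_end) => comp_lfunZl k f g).
HB.instance Definition _ := GRing.Lalgebra_isAlgebra.Build F ext_end
  (fun k (f g : ext_end) => comp_lfunZr k f g).
End ExtEnd.

Section ExtRepresentation.
Variables (R : realType) (n m : nat).
Local Notation q := (@q_ R).
Local Notation q0 := (q_neq0 R).
Local Notation qq0 := (qqV_neq0 R).
Local Notation E := (ext_end (Cq R) (n * m)).

Definition ext_rep : Clq R (n * m) -> E := @ext_act R (n * m).
HB.instance Definition _ :=
  GRing.isLinear.Build _ _ _ _ ext_rep (@ext_act_linear R (n * m)).
HB.instance Definition _ := GRing.isMonoidMorphism.Build _ _ ext_rep
  (conj (@ext_act1 R (n * m)) (@ext_actM R (n * m))).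

Local Notation M := (ext_rep \o @clq_pgen R (n * m)).

Lemma is_clq_ext : is_clq q M.
Proof.
have MX x : peval *%R 1 M x = ext_rep (peval *%R 1 (@clq_pgen R (n * m)) x).
  elim: x => //= [a|x -> y ->|x -> y ->].
  - by rewrite linearZ rmorph1.
  - by rewrite linearD.
  - by rewrite rmorphM.
by move=> x y xy; rewrite !MX (clq_pgen_is_clq xy).
Qed.

Lemma ext_om_eigen a : q *: M (GOmega a) + M (GOmegaV a) = (q + 1) *: 1.
Proof.
have := gen_act_om_eigen a q0; rewrite -!ext_act_gen; exact.
Qed.

Hypotheses (hn : (1 < n)%N) (hm : (1 < m)%N).

Lemma ext_Lq_gen g : ext_rep (Lq_gen (@clq_pgen R (n * m)) g) = Lq_gen M g.
Proof.
rewrite big_tensor_morph; apply: eq_big_tensor => p t.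
exact: root_vector_morph.
Qed.

Lemma ext_rho_gen g : ext_rep (rho_gen (@clq_pgen R (n * m)) g) = rho_gen M g.
Proof.
rewrite big_tensor_morph; apply: eq_big_tensor => p t.
exact: root_vector_morph.
Qed.

Lemma ext_RqB (j : 'I_m.-1) :
  ext_rep (RqB R n j) = sqrtN1 *: coideal_gen q (rho_gen M) (blk0 j).
Proof.
rewrite RqB_gen; transitivity
  (sqrtN1 *: ext_rep (coideal_gen q (rho_gen (@clq_pgen R (n * m))) (blk0 j))).
  exact: linearZ.
congr (_ *: _); transitivity
  (coideal_gen q (ext_rep \o rho_gen (@clq_pgen R (n * m))) (blk0 j)).
  exact: coideal_gen_morph.
apply: eq_coideal_gen => t; exact: ext_rho_gen.
Qed.

Lemma ext_Rq_Lq_comm (j : 'I_m.-1) g :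
  GRing.comm (ext_rep (RqB R n j)) (ext_rep (Lq_gen (@clq_pgen R (n * m)) g)).
Proof.
have := Lq_rho_comm hn hm is_clq_ext ext_om_eigen j g.
rewrite ext_RqB ext_Lq_gen; move: (coideal_gen _ _ _) (Lq_gen _ _) => x y xy.
exact: comm_scale.
Qed.
End ExtRepresentation.

(** The elements whose image commutes with z form a subalgebra, so the generators suffice. *)
Lemma palg_comm (F : fieldType) (G : Type) (rel : pexpr F G -> pexpr F G -> Prop)
    (A : algType F) (f : palg rel -> A) (z : A) :
  linear f -> monoid_morphism f ->
  (forall t, GRing.comm z (f (pgen rel t))) -> forall u, GRing.comm z (f u).
Proof.
move=> fl [f1 fM] fz.
have D (u v : palg rel) : f (u + v) = f u + f v.
  by have := fl 1 u v; rewrite !scale1r.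
have Z a (u : palg rel) : f (a *: u) = a *: f u.
  have f0 : f 0 = 0 by apply: (addrI (f 0)); rewrite -D !addr0.
  by have := fl a u 0; rewrite f0 !addr0.
elim/palgP; elim=> [t|a|x IHx y IHy|x IHx y IHy]; first exact: fz.
- rewrite pclass_const Z f1 /GRing.comm -scalerAr -scalerAl.
  by rewrite mulr1 mul1r.
- by rewrite pclassD D; exact: commrD.
by rewrite pclassM fM; exact: commrM.
Qed.

Lemma right_inv_uniq (A : pzRingType) (x y z : A) : y * x = 1 -> x * z = 1 -> z = y.
Proof. by move=> yx xz; rewrite -[z]mul1r -yx -mulrA xz mulr1. Qed.

Section Generators.
Variables (R : realType) (n m : nat).
Hypotheses (hn : (1 < n)%N) (hm : (1 < m)%N).
Variables (L : {lrmorphism Uqso2n R n -> Clq R (n * m)})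
  (Rq : {lrmorphism Uqso'm R m -> Clq R (n * m)}).
Hypotheses (HL : is_Lq L) (HR : is_Rq Rq).
Local Notation M := (@clq_pgen R (n * m)).

Lemma Lq_on_gen g : L (pgen _ g) = Lq_gen M g.
Proof.
have HX := Lq_gen_uq (@clq_pgen_is_clq R (n * m)) hn.
case: g => i; first by rewrite -LqE_gen; case: (HL i).
- by rewrite -LqF_gen; case: (HL i).
- by rewrite -LqK_gen; case: (HL i).
(* [is_Lq] does not prescribe the value on K_i^-1; uniqueness of inverses determines it. *)
have LK : L (uqK R i) = Lq_gen M (GK i) by rewrite -LqK_gen; case: (HL i).
have KKV : uqK R i * uqKV R i = 1.
  by rewrite -pclassM; apply/pclassP/pcong_rel/uqso_KV.
have := congr1 L KKV; rewrite rmorphM rmorph1 /= LK => h.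
exact: right_inv_uniq (uqKVK HX i) h.
Qed.

Lemma Lq_Rq_comm (x : Uqso2n R n) (y : Uqso'm R m) :
  GRing.comm (ext_rep (L x)) (ext_rep (Rq y)).
Proof.
have fl : linear (@ext_rep R n m \o Rq) by exact: linearP.
have fM : monoid_morphism (@ext_rep R n m \o Rq) by split=> [|u v] /=; rewrite ?rmorph1 ?rmorphM.
have gl : linear (@ext_rep R n m \o L) by exact: linearP.
have gM : monoid_morphism (@ext_rep R n m \o L) by split=> [|u v] /=; rewrite ?rmorph1 ?rmorphM.
(* First y is reduced to a generator B_j, then x to a generator of U_q(so_2n). *)
refine (@palg_comm (Cq R) _ (@uqso'_rel (Cq R) q_ m) (ext_end (Cq R) (n * m))
  (@ext_rep R n m \o Rq) _ fl fM _ y) => -[j].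
apply/commr_sym.
refine (@palg_comm (Cq R) _ (@uqso_rel (Cq R) q_ n) (ext_end (Cq R) (n * m))
  (@ext_rep R n m \o L) _ gl gM _ x) => g.
rewrite /= Lq_on_gen; have := @ext_Rq_Lq_comm R n m hn hm j g.
by rewrite -(HR j).
Qed.
End Generators.

Theorem mainTheorem2 (R : realType) (n m : nat)
    (hn : (2 <= n)%N) (hm : (2 <= m)%N) :
  [/\ exists L : {lrmorphism Uqso2n R n -> Clq R (n * m)}, is_Lq L,
      exists Rq : {lrmorphism Uqso'm R m -> Clq R (n * m)}, is_Rq Rq
    & forall (L : {lrmorphism Uqso2n R n -> Clq R (n * m)})
             (Rq : {lrmorphism Uqso'm R m -> Clq R (n * m)}),
        is_Lq L -> is_Rq Rq ->
        forall (x : Uqso2n R n) (y : Uqso'm R m),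
          (ext_act (L x) \o ext_act (Rq y))%VF
            = (ext_act (Rq y) \o ext_act (L x))%VF].
Proof.
split; [exact: Lq_exists | exact: Rq_exists |].
(* Composition is by definition the product of [ext_end], so commuting there is the claim. *)
by move=> L Rq HL HR x y; exact: Lq_Rq_comm.
Qed.
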